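(* Let $G=(\mathcal R,A_s)$ be a grammar and $w=w_1\cdots w_n\in\mathrm{WORDS}^*$ ($n\ge 0$). If the computation triggered by $w$ is successful, then $w\in L(G)$.
   Context: **Types, features, TFSs.** Fix non-empty finite disjoint sets $\mathrm{FEATS}$, $\mathrm{TYPES}$; $\mathrm{TYPES}$ has a partial order $\sqsubseteq$ in which every subset with an upper bound has a least upper bound (written $\sqcup$), with least element $\bot$ and greatest element $\top$. Fix an infinite set $\mathrm{NODES}$ with a typing function $\theta:\mathrm{NODES}\to\mathrm{TYPES}$ all of whose fibres are infinite. $\mathrm{PATHS}=\mathrm{FEATS}^*$, with empty path $\epsilon$. A typed feature structure (TFS) is $(Q,\bar q,\delta)$ with $Q\subseteq\mathrm{NODES}$ finite non-empty, $\bar q\in Q$, $\delta:Q\times\mathrm{FEATS}\to Q$ partial, every node reachable from $\bar q$; $\delta$ extends to paths. A multi-rooted structure (MRS) is a finite graph $(Q,\delta)$ of this kind with an ordered repetition-free list of roots $\bar q_1,\dots,\bar q_m\in Q$ from which jointly all of $Q$ is reachable; its length is $m$. A TFS is an MRS of length 1. **AMRSs.** A pre-AMRS is $A=\langle Ind,\Pi,\Theta,\approx\rangle$ with $Ind=\{1,\dots,m\}$ ($m\ge0$), $\Pi\subseteq Ind\times\mathrm{PATHS}$ containing some $(i,\pi)$ for each $i\in Ind$, $\Theta:\Pi\to\mathrm{TYPES}$ total, and $\approx$ a relation on $\Pi$. It is an abstract multi-rooted structure (AMRS) of length $len(A)=m$ if: $\Pi$ is prefix-closed ($(i,\pi\alpha)\in\Pi\Rightarrow(i,\pi)\in\Pi$);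 it is fusion-closed (if $(i,\pi\alpha),(i',\pi'\alpha')\in\Pi$ and $(i,\pi)\approx(i',\pi')$ then $(i,\pi\alpha'),(i',\pi'\alpha)\in\Pi$, $(i,\pi\alpha')\approx(i',\pi'\alpha')$ and $(i',\pi'\alpha)\approx(i,\pi\alpha)$); $\approx$ is an equivalence relation with finitely many classes; $\Theta$ is constant on classes. $\lambda$ is the AMRS of length 0. AMRSs of length 1 are identified with abstract feature structures (AFSs). For an MRS $\sigma$ with roots $\bar q_1,\dots,\bar q_m$, $Abs(\sigma)$ is the AMRS with $Ind=\{1,\dots,m\}$, $\Pi=\{(i,\pi)\mid\delta(\bar q_i,\pi)\text{ defined}\}$, $\Theta(i,\pi)=\theta(\delta(\bar q_i,\pi))$, $(i,\pi)\approx(j,\pi')$ iff $\delta(\bar q_i,\pi)=\delta(\bar q_j,\pi')$. $A\sqsubseteq B$ iff $Ind_A=Ind_B$, $\Pi_A\subseteq\Pi_B$, $\approx_A\subseteq\approx_B$, and $\Theta_A(i,\pi)\sqsubseteq\Theta_B(i,\pi)$ on $\Pi_A$. $A^{j\ldots k}$ is the sub-structure of $A$ on indices $j,\dots,k$, renumbered from 1; $A^j=A^{j\ldots j}$. The concatenation $A\cdot B$ juxtaposes $A$ and $B$ (shifting $B$'s indices by $len(A)$) with no $\approx$-pairs between the two parts. **Unification.** For a pre-AMRS: $Cl$ is the least extension to a prefix- and fusion-closed one (added paths get type $\bot$), $Eq$ replaces $\approx$ by the least equivalence relation on $\Pi$ containing it, $Ty$ replaces $\Theta(i,\pi)$ by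 $\bigsqcup_{(i',\pi')\approx(i,\pi)}\Theta(i',\pi')$. For an AMRS $A$, $J\subseteq Ind_A$, and $B$ either an AMRS with $J\subseteq Ind_B$ (put $f(i)=i$) or an AFS with $|J|=1$ (put $f(i)=1$), $(A,J)\sqcup B=Ty(Eq(Cl(C)))$, where $Ind_C=Ind_A$; $\Pi_C=\Pi_A\cup\{(i,\pi)\mid i\in J,(f(i),\pi)\in\Pi_B\}$; $\Theta_C(i,\pi)$ is $\Theta_A(i,\pi)$ if $i\notin J$, and for $i\in J$ it is the join of those of $\Theta_A(i,\pi)$, $\Theta_B(f(i),\pi)$ that are defined; $\approx_C=\approx_A\cup\{((i_1,\pi_1),(i_2,\pi_2))\mid i_1,i_2\in J,(f(i_1),\pi_1)\approx_B(f(i_2),\pi_2)\}$. The unification fails (is $\top$) if some path of the result has type $\top$. Convention: all structures in grammars, derivations and items have no element of type $\top$, and every unification used as an operand or in an equation below is required to be defined and not fail. For AFSs, $A\sqcup B=(A,\{1\})\sqcup B$. **Grammars.** Fix a set $\mathrm{WORDS}$ and a lexicon assigning to each word $u$ a set $Cat(u)$ of TFSs. A rule is an MRS of length $m>0$; its last element is its head, the first $m-1$ elements its body. A grammar $G=(\mathcal R,A_s)$ consists of a finite set $\mathcal R$ of rules and a TFS $A_s$. ($\mathcal R$ may contain rules of length 1, including lexical categories regarded as rules with empty body; no lexical category is the head of a rule of length $>1$.) For $w=w_1\cdots w_n$, $PT_w(j,k)$ is the set of AMRSs $Abs(A_j)\cdot\ldots\cdot Abs(A_k)$ with $A_i\in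 Cat(w_i)$; $PT_w(j,k)=\{\lambda\}$ if $j>k$. **Derivation.** An AMRS $A$ of length $k$ strongly derives $B$, $A\rightarrow B$, iff there are $\rho\in\mathcal R$, an AMRS $R\sqsupseteq Abs(\rho)$ of length $m$, and $j\in Ind_A$ such that: $A=(A,\{j\})\sqcup R^m$ and $R=(R,\{m\})\sqcup A^j$; if $m\ge2$, there is $i$ such that, writing $S=B^{i\ldots i+m-2}$, $S=(S,\{1,\dots,m-1\})\sqcup R^{1\ldots m-1}$ and $R=(R,\{1,\dots,m-1\})\sqcup S$; and $B$ is the replacement of the $j$-th element of $A$ by the body of $R$, i.e. with $f(i)=i$ for $1\le i<j$, $f(i)=i+m-2$ for $j<i\le k$, $g(i)=i+j-1$ for $1\le i<m$, $B=Ty(Eq(Cl(B')))$ where $Ind_{B'}=\{1,\dots,k+m-2\}$; $\Pi_{B'}=\{(f(i),\pi)\mid(i,\pi)\in\Pi_A,i\ne j\}\cup\{(g(i),\pi)\mid(i,\pi)\in\Pi_R,i<m\}$; $\Theta_{B'}(f(i),\pi)=\Theta_A(i,\pi)$, $\Theta_{B'}(g(i),\pi)=\Theta_R(i,\pi)$; and $\approx_{B'}$ consists of the pairs $(f(i_1),\pi_1),(f(i_2),\pi_2)$ with $(i_1,\pi_1)\approx_A(i_2,\pi_2)$, the pairs $(g(i_1),\pi_1),(g(i_2),\pi_2)$ with $(i_1,\pi_1)\approx_R(i_2,\pi_2)$, and, in both orders, the pairs $(f(i_1),\pi_1),(g(i_2),\pi_2)$ for which some $\pi_3$ satisfies $(i_1,\pi_1)\approx_A(j,\pi_3)$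 and $(m,\pi_3)\approx_R(i_2,\pi_2)$. $\stackrel{*}{\rightarrow}$ is the reflexive transitive closure of $\rightarrow$. $A$ derives $B$, $A\leadsto B$, iff there are AMRSs $A',B'$ with $len(A')=len(A)$, $(A,\{1,\dots,len(A)\})\sqcup A'\ne\top$, $B\sqsubseteq B'$ and $A'\stackrel{*}{\rightarrow}B'$. $L(G)=\{w=w_1\cdots w_n\in\mathrm{WORDS}^*\mid Abs(A_s)\leadsto B\text{ for some }B\in PT_w(1,n)\}$. **Computation.** An item is $[i,A,j,c]$ with $i\le j$ in $\mathbb N$, $A$ an AMRS, $c\in\{\mathrm{Act},\mathrm{Comp}\}$. For a set $I$ of items, $x\in T_{G,w}(I)$ iff one of: (1) there are $\rho\in\mathcal R$ of length $m>1$ with $R=Abs(\rho)$, $k<m-1$, $[i_\alpha,A_\alpha,j_\alpha,\mathrm{Act}]\in I$ with $len(A_\alpha)=k$, $[i_\beta,A_\beta,j_\beta,\mathrm{Comp}]\in I$ with $len(A_\beta)=1$, $j_\alpha=i_\beta$, $B=(R,\{1,\dots,k\})\sqcup A_\alpha$, $C=(B,\{k+1\})\sqcup A_\beta$, $x=[i_\alpha,C^{1\ldots k+1},j_\beta,\mathrm{Act}]$; (2) there are $\rho\in\mathcal R$ of length $m>1$ with $R=Abs(\rho)$ and $[i_\alpha,A_\alpha,j_\alpha,\mathrm{Act}]\in I$ with $len(A_\alpha)=m-1$, $C=(R,\{1,\dots,m-1\})\sqcup A_\alpha$, $x=[i_\alpha,C^m,j_\alpha,\mathrm{Comp}]$;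 (3) $x=[i,\lambda,i,\mathrm{Act}]$ for some $0\le i\le n$; (4) $x=[i,Abs(\rho),i,\mathrm{Comp}]$ for some $0\le i\le n$ and $\rho\in\mathcal R$ of length 1; (5) $x=[i-1,Abs(A_i),i,\mathrm{Comp}]$ for some $0<i\le n$, $A_i\in Cat(w_i)$. The computation triggered by $w$ is the sequence $I_0=\emptyset$, $I_{l+1}=T_{G,w}(I_l)$. It is successful if for some $l$ there is $[0,A,n,\mathrm{Comp}]\in I_l$ with $len(A)=1$ and $A\sqcup Abs(A_s)\ne\top$. *)

(* Defs.v *)
From mathcomp Require Import all_boot all_order.
From mathcomp Require Import boolp classical_sets functions cardinality.
From Stdlib Require Import Relation_Operators.

Set Implicit Arguments.
Unset Strict Implicit.
Unset Printing Implicit Defensive.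
Local Open Scope classical_set_scope.

Definition bounded_complete {d} (T : porderType d) :=
  forall S : set T, has_ubound S -> supremums S !=set0.

(* Least upper bound of S. The default value \bot of [supremum] is only reached
   for S = set0, whose least upper bound it is: all other sets are bounded by
   \top, hence have a supremum when T is bounded complete. *)
Definition lub {d} (T : finTBPOrderType d) (S : set T) : T :=
  supremum (\bot%O : T) S.

Section MultiRootedStructures.
Variables (F : finType) (N : eqType).

Fixpoint dpath (delta : N -> F -> option N) (q : N) (p : seq F) : option N :=
  if p is f :: p' then obind (fun q' => dpath delta q' p') (delta q f)
  else Some q.

(* The transition function is undefined outside of Q, so that equality of
   records is equality of structures. *)
Record mrs := Mrs {
  mrs_nodes : set N;
  mrs_delta : N -> F -> option N;
  mrs_roots : seq N;
  nodes_finite : finite_set mrs_nodes;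
  deltaP : forall q f q', mrs_delta q f = Some q' -> mrs_nodes q /\ mrs_nodes q';
  roots_uniq : uniq mrs_roots;
  roots_nodes : forall q, q \in mrs_roots -> mrs_nodes q;
  nodes_reachable : forall q, mrs_nodes q ->
    exists r p, r \in mrs_roots /\ dpath mrs_delta r p = Some q }.

Record tfs := Tfs { tfs_mrs :> mrs; tfs_size : size (mrs_roots tfs_mrs) = 1 }.

End MultiRootedStructures.

Section AbstractStructures.
Variables (F : finType) (d : Order.disp_t) (T : finTBPOrderType d).

(* Indices are natural numbers starting from 1. *)
Definition ipath := (nat * seq F)%type.

(* The index set is {1, ..., len}. The set of paths is not a separate field: it
   is the domain of the (partial) typing function. With this encoding equality
   of records is, by extensionality, equality of structures. *)
Record pre_amrs := PreAmrs {
  len : nat;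
  typ : ipath -> option T;
  reent : ipath -> ipath -> Prop }.

Definition paths (A : pre_amrs) : set ipath :=
  [set x | exists t, typ A x = Some t].

Definition prefix_closed (P : set ipath) :=
  forall i p a, P (i, p ++ a) -> P (i, p).

Definition fusion_closed (P : set ipath) (E : ipath -> ipath -> Prop) :=
  forall i p a i' p' a',
    P (i, p ++ a) -> P (i', p' ++ a') -> E (i, p) (i', p') ->
    [/\ P (i, p ++ a'), P (i', p' ++ a),
        E (i, p ++ a') (i', p' ++ a') & E (i', p' ++ a) (i, p ++ a)].

Definition equivalence_on (P : set ipath) (E : ipath -> ipath -> Prop) :=
  [/\ forall x y, E x y -> P x /\ P y,
      forall x, P x -> E x x,
      forall x y, E x y -> E y x
    & forall x y z, E x y -> E y z -> E x z].

Definition is_pre_amrs (A : pre_amrs) :=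
  [/\ forall i p, paths A (i, p) -> 1 <= i <= len A,
      forall i, 1 <= i <= len A -> exists p, paths A (i, p)
    & forall x y, reent A x y -> paths A x /\ paths A y].

Definition is_amrs (A : pre_amrs) :=
  is_pre_amrs A /\
  [/\ prefix_closed (paths A),
      fusion_closed (paths A) (reent A),
      equivalence_on (paths A) (reent A),
      finite_set [set [set y | reent A x y] | x in paths A]
    & forall x y, reent A x y -> typ A x = typ A y].

Definition top_free (A : pre_amrs) := forall x, typ A x <> Some (\top%O : T).

Definition subsumes (A B : pre_amrs) :=
  [/\ len A = len B,
      paths A `<=` paths B,
      forall x y, reent A x y -> reent B x y
    & forall x s t, typ A x = Some s -> typ B x = Some t -> (s <= t)%O].

Definition lambda : pre_amrs :=
  PreAmrs 0 (fun _ => None) (fun _ _ => False).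

Definition concat (A B : pre_amrs) : pre_amrs :=
  let shift (x : ipath) := (x.1 - len A, x.2) in
  PreAmrs (len A + len B)
    (fun x => if x.1 <= len A then typ A x else typ B (shift x))
    (fun x y =>
       [/\ x.1 <= len A, y.1 <= len A & reent A x y] \/
       [/\ len A < x.1, len A < y.1 & reent B (shift x) (shift y)]).

(* A^{j...k}, for 1 <= j and k <= len A. *)
Definition sub (A : pre_amrs) (j k : nat) : pre_amrs :=
  let l := k.+1 - j in
  let shift (x : ipath) := (x.1 + j - 1, x.2) in
  PreAmrs l
    (fun x => if 1 <= x.1 <= l then typ A (shift x) else None)
    (fun x y => [/\ 1 <= x.1 <= l, 1 <= y.1 <= l
                  & reent A (shift x) (shift y)]).

Definition elt (A : pre_amrs) (j : nat) := sub A j j.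

(* The closing family in the definition of [Cl]: the least closed extension is
   the intersection of all of them. *)
Definition closed_extension (A : pre_amrs) (P : set ipath)
    (E : ipath -> ipath -> Prop) :=
  [/\ paths A `<=` P, forall x y, reent A x y -> E x y,
      prefix_closed P & fusion_closed P E].

Definition cl_paths (A : pre_amrs) : set ipath :=
  [set x | forall P E, closed_extension A P E -> P x].

Definition cl_reent (A : pre_amrs) (x y : ipath) :=
  forall P E, closed_extension A P E -> E x y.

Definition Cl (A : pre_amrs) : pre_amrs :=
  PreAmrs (len A)
    (fun x => if typ A x is Some t then Some t
              else if `[< cl_paths A x >] then Some (\bot%O : T) else None)
    (cl_reent A).

Definition Eq (A : pre_amrs) : pre_amrs :=
  PreAmrs (len A) (typ A)
    (fun x y => forall E : ipath -> ipath -> Prop,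
       equivalence_on (paths A) E ->
       (forall u v, reent A u v -> E u v) -> E x y).

Definition Ty (A : pre_amrs) : pre_amrs :=
  PreAmrs (len A)
    (fun x => omap (fun=> lub [set t | exists2 y, reent A y x
                                       & typ A y = Some t]) (typ A x))
    (reent A).

Definition ojoin (s t : option T) : option T :=
  match s, t with
  | Some s', Some t' => Some (lub [set s'; t'])
  | Some s', None => Some s'
  | None, _ => t
  end.

Definition unif_merge (f : nat -> nat) (A : pre_amrs) (J : pred nat)
    (B : pre_amrs) : pre_amrs :=
  PreAmrs (len A)
    (fun x => if J x.1 then ojoin (typ A x) (typ B (f x.1, x.2)) else typ A x)
    (fun x y => reent A x y \/
       [/\ J x.1, J y.1 & reent B (f x.1, x.2) (f y.1, y.2)]).

(* (A, J) |_| B, for B an AMRS whose index set contains J. *)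
Definition unify (A : pre_amrs) (J : pred nat) (B : pre_amrs) : pre_amrs :=
  Ty (Eq (Cl (unif_merge id A J B))).

(* (A, {j}) |_| B, for B an AFS, i.e., an AMRS of length 1. *)
Definition unify1 (A : pre_amrs) (j : nat) (B : pre_amrs) : pre_amrs :=
  Ty (Eq (Cl (unif_merge (fun=> 1) A (pred1 j) B))).

Definition upto (k : nat) : pred nat := [pred i | 1 <= i <= k].

Definition repl_f (j m i : nat) : nat := if i < j then i else i + m - 2.

Definition repl_g (j i : nat) : nat := i + j - 1.

(* The structure B' in which the j-th element of A is replaced by the body of
   R. In the typing function, the three cases for an index are: f(i) with
   i < j, g(i) with i < m, and f(i) with i > j; the index i is recovered by
   inverting f and g. *)
Definition replace (A : pre_amrs) (j : nat) (R : pre_amrs) : pre_amrs :=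
  let k := len A in
  let m := len R in
  let f := repl_f j m in
  let g := repl_g j in
  PreAmrs (k + m - 2)
    (fun x =>
       let: (l, p) := x in
       if l < j then typ A (l, p)
       else if l < j + m - 1 then typ R (l + 1 - j, p)
       else typ A (l + 2 - m, p))
    (fun x y =>
       [\/ exists i1 i2 p1 p2,
             [/\ i1 <> j, i2 <> j, x = (f i1, p1), y = (f i2, p2)
               & reent A (i1, p1) (i2, p2)],
           exists i1 i2 p1 p2,
             [/\ i1 < m, i2 < m, x = (g i1, p1), y = (g i2, p2)
               & reent R (i1, p1) (i2, p2)]
         | exists i1 i2 p1 p2,
             [/\ i1 <> j, i2 < m,
                 (x = (f i1, p1) /\ y = (g i2, p2)) \/
                 (x = (g i2, p2) /\ y = (f i1, p1))
               & exists p3, reent A (i1, p1) (j, p3) /\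
                            reent R (m, p3) (i2, p2)]]).

End AbstractStructures.

Arguments lambda {F d T}.

Section Abstraction.
Variables (F : finType) (d : Order.disp_t) (T : finTBPOrderType d).
Variables (N : eqType) (theta : N -> T).

Definition node_at (s : mrs F N) (x : ipath F) : option N :=
  if x.1 is i.+1
  then obind (fun q => dpath (mrs_delta s) q x.2) (onth (mrs_roots s) i)
  else None.

Definition Abs (s : mrs F N) : pre_amrs F T :=
  PreAmrs (size (mrs_roots s))
    (fun x => omap theta (node_at s x))
    (fun x y => exists2 q, node_at s x = Some q & node_at s y = Some q).

End Abstraction.

Section Grammars.
Variables (F : finType) (d : Order.disp_t) (T : finTBPOrderType d).
Variables (N : eqType) (theta : N -> T) (W : Type).

Record lexicon := Lexicon {
  cat :> W -> set (tfs F N);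
  cat_top_free : forall u A, cat u A -> top_free (Abs theta A) }.

(* Feature structures with the same abstraction differ only in the identity of
   their nodes; a lexical category and the head of a rule are compared up to
   this renaming. *)
Record grammar (Cat : lexicon) := Grammar {
  rules : set (mrs F N);
  start : tfs F N;
  rules_finite : finite_set rules;
  rules_len : forall rho, rules rho -> 0 < size (mrs_roots rho);
  rules_top_free : forall rho, rules rho -> top_free (Abs theta rho);
  start_top_free : top_free (Abs theta start);
  rules_head : forall rho, rules rho -> 1 < size (mrs_roots rho) ->
    forall u A, Cat u A ->
      elt (Abs theta rho) (size (mrs_roots rho)) <> Abs theta A }.

Fixpoint PTseq (Cat : lexicon) (w : seq W) : set (pre_amrs F T) :=
  if w is u :: w'
  then [set concat (Abs theta (tfs_mrs A)) B | A in Cat u & B in PTseq Cat w']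
  else [set lambda].

(* PT_w(j, k), for 1 <= j and k <= size w *)
Definition PT (Cat : lexicon) (w : seq W) (j k : nat) : set (pre_amrs F T) :=
  PTseq Cat (drop (j - 1) (take k w)).

Variables (Cat : lexicon) (G : grammar Cat).

Definition strongly_derives (A B : pre_amrs F T) :=
  [/\ is_amrs A, top_free A, is_amrs B, top_free B &
  exists (rho : mrs F N) (R : pre_amrs F T) (j : nat),
    let m := size (mrs_roots rho) in
    [/\ rules G rho,
        [/\ is_amrs R, top_free R & subsumes (Abs theta rho) R],
        [/\ 1 <= j <= len A,
            A = unify1 A j (elt R m)
          & R = unify1 R m (elt A j)],
        2 <= m ->
          exists i, [/\ 1 <= i, i + m - 2 <= len B &
            let S := sub B i (i + m - 2) in
            S = unify S (upto (m - 1)) (sub R 1 (m - 1)) /\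
            R = unify R (upto (m - 1)) S]
      & B = Ty (Eq (Cl (replace A j R)))]].

Definition derives (A B : pre_amrs F T) :=
  exists A' B' : pre_amrs F T,
    [/\ [/\ is_amrs A', top_free A', is_amrs B' & top_free B'],
        len A' = len A,
        top_free (unify A (upto (len A)) A'),
        subsumes B B'
      & clos_refl_trans _ strongly_derives A' B'].

Definition language : set (seq W) :=
  [set w | exists2 B, PT Cat w 1 (size w) B & derives (Abs theta (start G)) B].

Inductive status := Act | Comp.

Record item := Item {
  ifrom : nat;
  icat : pre_amrs F T;
  ito : nat;
  istatus : status }.

Definition is_item (x : item) :=
  [/\ ifrom x <= ito x, is_amrs (icat x) & top_free (icat x)].

Variable w : seq W.

Definition T_extend (I : set item) (x : item) :=
  exists (rho : mrs F N) (k ia ja ib jb : nat) (Aa Ab : pre_amrs F T),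
    let m := size (mrs_roots rho) in
    let B := unify (Abs theta rho) (upto k) Aa in
    let C := unify1 B k.+1 Ab in
    [/\ rules G rho /\ 1 < m,
        k < m - 1,
        [/\ I (Item ia Aa ja Act), len Aa = k,
            I (Item ib Ab jb Comp), len Ab = 1 & ja = ib],
        top_free B /\ top_free C
      & x = Item ia (sub C 1 k.+1) jb Act].

Definition T_complete (I : set item) (x : item) :=
  exists (rho : mrs F N) (ia ja : nat) (Aa : pre_amrs F T),
    let m := size (mrs_roots rho) in
    let C := unify (Abs theta rho) (upto (m - 1)) Aa in
    [/\ rules G rho /\ 1 < m,
        I (Item ia Aa ja Act) /\ len Aa = m - 1,
        top_free C
      & x = Item ia (elt C m) ja Comp].

Definition T_init (x : item) :=
  exists2 i, i <= size w & x = Item i lambda i Act.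

Definition T_empty (x : item) :=
  exists i rho, [/\ i <= size w, rules G rho, size (mrs_roots rho) = 1
    & x = Item i (Abs theta rho) i Comp].

Definition T_scan (x : item) :=
  exists i u (A : tfs F N), [/\ 0 < i <= size w, onth w (i - 1) = Some u, Cat u A
    & x = Item (i - 1) (Abs theta A) i Comp].

Definition T_step (I : set item) : set item :=
  [set x | is_item x /\
     [\/ T_extend I x, T_complete I x | [\/ T_init x, T_empty x | T_scan x]]].

Definition computation (l : nat) : set item := iter l T_step set0.

Definition successful :=
  exists l A,
    [/\ computation l (Item 0 A (size w) Comp), len A = 1
      & top_free (unify1 A 1 (Abs theta (start G)))].

End Grammars.

(* Main.v *)
(* An AMRS Z is compared elementwise with a list s of feature structures, the
   sharing between elements of Z being disregarded. With this comparison,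
   derivation is context-free rewriting of lists: call s -> t when every Z above
   s1 s s2, for arbitrary s1 and s2, derives some Z' above s1 t s2. For every
   complete item [i, A, j], A -> t for a list t of categories of the words of w
   between i and j; for every active item [i, A, j], A is elementwise above a
   list s with such an s -> t. The crux is the completion of a rule instance C
   of length m. If Z^j is above C^m, let R be the pushout of C and Z^j over C^m:
   its nodes reachable from the head come from Z^j and the other ones from C, so
   it is free of top and R^m = Z^j. Replacing Z^j by the body of R gives a part
   of the amalgam of Z and R over Z^j = R^m, which is already closed, so that
   the body of R and the other elements of Z persist unchanged. *)
Require Import Defs.
From mathcomp Require Import all_boot all_order.
From mathcomp Require Import boolp classical_sets functions cardinality.
From mathcomp Require Import zify.
From Stdlib Require Import Relation_Operators.
Set Implicit Arguments.
Unset Strict Implicit.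
Unset Printing Implicit Defensive.
Import Order.TTheory.
Local Open Scope classical_set_scope.

(** * Joins, finitely many classes, extension of paths *)

Lemma lub_supremum d (T : finTBPOrderType d) (S : set T) :
  bounded_complete T -> supremums S (lub S).
Proof.
move=> T_bc; rewrite /lub /supremum; case: eqP => [->|_].
  by split=> [t []|t _]; rewrite ?le0x.
have [t St] : supremums S !=set0 by apply: T_bc; exists \top%O => t _; apply: lex1.
by apply: xgetPex; exists t.
Qed.

Lemma lub_eq d (T : finTBPOrderType d) (S : set T) (t : T) :
  bounded_complete T -> supremums S t -> lub S = t.
Proof. by move=> /(@lub_supremum _ _ S) + St => /is_subset1_supremums; apply. Qed.

Lemma finite_classesP F (P : set (ipath F)) E : equivalence_on P E ->
  finite_set [set [set y | E x y] | x in P] ->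
  exists s : seq (ipath F), forall x, P x -> exists2 y, y \in s & E x y.
Proof.
move=> [_ Erefl _ _] /finite_seqP[r cls].
(* The default [(0, [::])] is never chosen for the class of an element of [P], which is non-empty by
   reflexivity. *)
exists [seq xget (0, [::]) K | K <- r] => x Px.
exists (xget (0, [::]) [set y | E x y]).
  apply: map_f; have : [set [set y | E x y] | x in P] [set y | E x y] by exists x.
  by rewrite cls.
by apply: (@xgetPex _ (0, [::]) [set y | E x y]); exists x; apply: Erefl.
Qed.

(** The class of [x] is the saturation of any piece [K k] that contains [x], so there are at most as
    many classes as pieces. The pieces may overlap and need not be saturated. *)
Lemma finite_classes_cover F (X : eqType) (s : seq X) (K : X -> set (ipath F))
    (P : set (ipath F)) E : equivalence_on P E ->
  (forall x, P x -> exists2 k, k \in s & K k x) ->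
  (forall k x y, P x -> P y -> K k x -> K k y -> E x y) ->
  finite_set [set [set y | E x y] | x in P].
Proof.
move=> [_ Erefl Esym Etrans] cover clique.
apply: sub_finite_set (finite_image
  (fun k => [set y | exists z, [/\ P z, K k z & E z y]]) (finite_seq s)).
move=> _ [x Px <-]; have [k sk Kx] := cover x Px.
exists k => //; rewrite predeqE => y; split=> [[z [Pz Kz zy]]|xy]; last by exists x.
exact: Etrans (clique _ _ _ Px Pz Kx Kz) zy.
Qed.

Lemma cat_eqP (S : eqType) (p a q b : seq S) : p ++ a = q ++ b ->
  (exists2 c, p = q ++ c & b = c ++ a) \/ (exists2 c, q = p ++ c & a = c ++ b).
Proof.
elim: p q => [|x p IHp] [|y q] /=; first by left; exists [::].
- by move->; right; exists (y :: q).
- by move<-; left; exists (x :: p).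
- by case=> -> /IHp[[c -> ->]|[c -> ->]]; [left|right]; exists c.
Qed.

Definition ext {F : finType} (x : ipath F) (a : seq F) : ipath F := (x.1, x.2 ++ a).

Lemma ext_nil (F : finType) (x : ipath F) : ext x [::] = x.
Proof. by case: x => i p; rewrite /ext cats0. Qed.

Lemma ext_cat (F : finType) (x : ipath F) a b : ext (ext x a) b = ext x (a ++ b).
Proof. by rewrite /ext /= catA. Qed.

(** Symmetry turns the one-sided congruence into both halves of fusion; the new paths lie in [P]
    because [E] relates only elements of [P]. *)
Lemma fusion_closed_ext (F : finType) (P : set (ipath F)) E : equivalence_on P E ->
  (forall x y a, E x y -> P (ext y a) -> E (ext x a) (ext y a)) ->
  fusion_closed P E.
Proof.
move=> [EP _ Esym _] Eext i p a i' p' a' Pa Pa' E0.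
have E1 := Eext _ _ _ E0 Pa'.
have E2 := Eext _ _ _ (Esym _ _ E0) Pa.
by have [? _] := EP _ _ E1; have [? _] := EP _ _ E2; split.
Qed.

(** * Closure and unification *)

Section Closure.
Variables (F : finType) (d : Order.disp_t) (T : finTBPOrderType d).
Implicit Types (A B X : pre_amrs F T) (x y : ipath F).

Lemma pre_amrs_ext A B : len A = len B -> typ A =1 typ B ->
  (forall x y, reent A x y <-> reent B x y) -> A = B.
Proof.
case: A B => lA tA rA [lB tB rB] /= -> /funext -> rAB; congr PreAmrs.
by apply: funext => x; apply: funext => y; apply: propext.
Qed.

Section Amrs.
Variables (A : pre_amrs F T) (A_amrs : is_amrs A).

Lemma amrs_index x : paths A x -> 1 <= x.1 <= len A.
Proof. by case: A_amrs => -[H _ _] _; case: x => i p; apply: H. Qed.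

Lemma amrs_root i : 1 <= i <= len A -> paths A (i, [::]).
Proof.
by case: A_amrs => -[_ H _] [Hp _ _ _ _] /H[p ip]; apply: (Hp i [::] p).
Qed.

Lemma amrs_prefix x a : paths A (ext x a) -> paths A x.
Proof. by case: A_amrs => _ [H _ _ _ _]; case: x => i p; apply: H. Qed.

Lemma amrs_paths x y : reent A x y -> paths A x /\ paths A y.
Proof. by case: A_amrs => -[_ _ H] _; apply: H. Qed.

Lemma amrs_refl x : paths A x -> reent A x x.
Proof. by case: A_amrs => _ [_ _ [_ H _ _] _ _]; apply: H. Qed.

Lemma amrs_sym x y : reent A x y -> reent A y x.
Proof. by case: A_amrs => _ [_ _ [_ _ H _] _ _]; apply: H. Qed.

Lemma amrs_trans x y z : reent A x y -> reent A y z -> reent A x z.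
Proof. by case: A_amrs => _ [_ _ [_ _ _ H] _ _]; apply: H. Qed.

Lemma amrs_typ x y : reent A x y -> typ A x = typ A y.
Proof. by case: A_amrs => _ [_ _ _ _ H]; apply: H. Qed.

Lemma amrs_fusion x y a : reent A x y -> paths A (ext y a) ->
  reent A (ext x a) (ext y a).
Proof.
move=> xy ya; case: A_amrs => _ [_ H _ _ _]; have [Px Py] := amrs_paths xy.
move: x y xy ya Px Py => [i p] [j q] xy ya Px Py.
by case: (H i p [::] j q a); rewrite ?cats0.
Qed.

Lemma amrs_reps : exists s : seq (ipath F),
  forall x, paths A x -> exists2 y, y \in s & reent A x y.
Proof. by case: A_amrs => _ [_ _ H1 H2 _]; apply: finite_classesP. Qed.

End Amrs.

(** The criterion behind all constructions of AMRSs below; finiteness of the set of classes is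
    supplied as a finite cover by cliques. *)
Lemma is_amrsI A (X : eqType) (s : seq X) (K : X -> set (ipath F)) :
  (forall x, paths A x -> 1 <= x.1 <= len A) ->
  (forall i, 1 <= i <= len A -> paths A (i, [::])) ->
  (forall x a, paths A (ext x a) -> paths A x) ->
  equivalence_on (paths A) (reent A) ->
  (forall x y a, reent A x y -> paths A (ext y a) -> reent A (ext x a) (ext y a)) ->
  (forall x, paths A x -> exists2 k, k \in s & K k x) ->
  (forall k x y, paths A x -> paths A y -> K k x -> K k y -> reent A x y) ->
  (forall x y, reent A x y -> typ A x = typ A y) ->
  is_amrs A.
Proof.
move=> Aidx Aroot Apre Aeq Afus cover clique Atyp; split.
  split=> [i p /Aidx //|i /Aroot|]; first by exists [::].
  by case: Aeq.
split=> //; last exact: finite_classes_cover cover clique.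
  by move=> i p a; apply: (Apre (i, p)).
exact: fusion_closed_ext.
Qed.

(** The common tail of both unifications and of the replacement in a derivation step, which all
    unfold to it. *)
Definition closure X : pre_amrs F T := Ty (Eq (Cl X)).

Lemma paths_Cl X : paths (Cl X) = cl_paths X.
Proof.
rewrite predeqE => x; rewrite /paths /=; split=> [[t]|].
  case E: (typ X x) => [s|]; last by case: asboolP.
  by move=> _ P E' [H _ _ _]; apply: H; exists s.
case: (typ X x) => [s _|xP]; first by exists s.
by case: asboolP => // _; exists \bot%O.
Qed.

Lemma typ_closure X x : typ (closure X) x =
  omap (fun=> lub [set t | exists2 y, reent (closure X) y x & typ (Cl X) y = Some t])
       (typ (Cl X) x).
Proof. by []. Qed.

Lemma paths_closure X : paths (closure X) = cl_paths X.
Proof.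
rewrite -paths_Cl predeqE => x; rewrite /paths /mkset typ_closure.
by case: (typ (Cl X) x) => [t|] /=; split=> -[s] //; eexists.
Qed.

(** The closedness conditions are Horn clauses, hence preserved when all closed extensions are
    intersected. *)
Lemma cl_closed X : closed_extension X (cl_paths X) (cl_reent X).
Proof.
split.
- by move=> x Px P E [H _ _ _]; apply: H.
- by move=> x y xy P E [_ H _ _]; apply: H.
- move=> i p a Pa P E H; case: (H) => _ _ Ppre _.
  exact: Ppre (Pa _ _ H).
- move=> i p a i' p' a' Pa Pa' E0.
  by split=> P E H; case: (H) => _ _ _ Pfus;
    case: (Pfus i p a i' p' a' (Pa _ _ H) (Pa' _ _ H) (E0 _ _ H)).
Qed.

Lemma eq_Cl_equivalence X : (forall x y, cl_reent X x y -> cl_paths X x /\ cl_paths X y) ->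
  equivalence_on (cl_paths X) (reent (closure X)).
Proof.
move=> EP; rewrite /= paths_Cl; split.
(* By hypothesis the full relation on [cl_paths X] is among the equivalences that are
   intersected. *)
- move=> x y /(_ (fun x y => cl_paths X x /\ cl_paths X y)); apply=> //.
  by split=> [||? ? []|? ? ? [? ?] []].
- by move=> x Px E [_ H _ _] _; apply: H.
- by move=> x y xy E H1 H2; case: (H1) => _ _ H _; apply: H; apply: xy.
- by move=> x y z xy yz E H1 H2; case: (H1) => _ _ _ H; apply: (H _ y); [apply: xy|apply: yz].
Qed.

(** An AMRS is its own least closed extension, its relation is already an equivalence, and its types
    are constant on classes, so that [Ty] joins singletons only. *)
Lemma closure_id X : bounded_complete T -> is_amrs X -> closure X = X.
Proof.
move=> T_bc XA; case: (XA) => -[_ _ XP] [Xpre Xfus Xeq _ Xtyp].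
have Xcl : closed_extension X (paths X) (reent X) by split.
have PX : cl_paths X = paths X.
  rewrite predeqE => x; split=> [/(_ _ _ Xcl) //|].
  by case: (cl_closed X) => H _ _ _; apply: H.
have EX x y : reent (closure X) x y <-> reent X x y.
  rewrite /= paths_Cl PX; split=> [xy|xy E _ H].
    by apply: xy Xeq _ => u v /(_ _ _ Xcl).
  by apply: H => P E' [_ + _ _]; apply.
have tX x : typ (Cl X) x = typ X x.
  rewrite /=; case E: (typ X x) => [t //|]; rewrite PX.
  by case: asboolP => // -[t]; rewrite E.
apply: pre_amrs_ext => // x.
rewrite typ_closure tX; case E: (typ X x) => [t|//] /=; congr Some.
apply: lub_eq => //; split=> [s [y /EX yx]|s]; last first.
  by apply; exists x; [apply/EX; apply: amrs_refl => //; exists t|exact: etrans (tX x) E].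
by move/(etrans (esym (tX y))); rewrite (amrs_typ XA yx) E => -[->].
Qed.

(* The condition, for given f and J, under which B contributes nothing to the
   unification with A. *)
Definition embeds (f : nat -> nat) (J : pred nat) B A :=
  (forall i p t, J i -> typ B (f i, p) = Some t ->
     exists2 t', typ A (i, p) = Some t' & (t <= t')%O) /\
  (forall i j p q, J i -> J j -> reent B (f i, p) (f j, q) ->
     reent A (i, p) (j, q)).

(** Convertible to [unify] for [f = id], and to [unify1] for [f] constantly 1 and [J = pred1 j]. *)
Definition unif f A J B : pre_amrs F T := closure (unif_merge f A J B).

(** The merge joins types of [A] only with smaller ones and adds only reentrancies already there, so
    it is [A] up to the closure, and [closure_id] applies. All unification equations demanded by a
    derivation step are proved in this way. *)
Lemma unif_absorb f A (J : pred nat) B : bounded_complete T -> is_amrs A ->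
  embeds f J B A -> unif f A J B = A.
Proof.
move=> T_bc A_amrs [Btyp Breent].
suff -> : unif f A J B = closure A by apply: closure_id.
congr closure; apply: pre_amrs_ext => // [[i p]|[i p] [j q]] /=.
  case: ifP => // Ji; case E: (typ B _) => [t|]; last by case: (typ A _).
  have [t' -> le_tt'] := Btyp _ _ _ Ji E; congr Some; apply: lub_eq => //.
  split=> [s [->|->] //|s]; by apply; left.
by split=> [[//|[Ji Jj]]|]; [apply: Breent | left].
Qed.

Lemma closure_embeds X : bounded_complete T -> embeds id predT X (closure X).
Proof.
move=> T_bc; split=> [i p t _ tX|i j p q _ _ xy E _ H]; last first.
  by apply: H => P E' [_ + _ _]; apply.
have tCl : typ (Cl X) (i, p) = Some t by rewrite /= tX.
eexists; first by rewrite typ_closure tCl.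
have [+ _] := lub_supremum
  [set s | exists2 y, reent (closure X) y (i, p) & typ (Cl X) y = Some s] T_bc.
by apply; exists (i, p) => // E [_ H _ _] _; apply: H; exists t.
Qed.

Lemma le_ojoinl (t : T) (o : option T) : bounded_complete T ->
  exists2 t', ojoin (Some t) o = Some t' & (t <= t')%O.
Proof.
move=> T_bc; case: o => [u|] /=; eexists=> //.
by have [+ _] := lub_supremum [set t; u] T_bc; apply; left.
Qed.

Lemma le_ojoinr (t : T) (o : option T) : bounded_complete T ->
  exists2 t', ojoin o (Some t) = Some t' & (t <= t')%O.
Proof.
move=> T_bc; case: o => [u|] /=; eexists=> //.
by have [+ _] := lub_supremum [set u; t] T_bc; apply; right.
Qed.

Lemma unif_embedsl f A J B : bounded_complete T -> embeds id predT A (unif f A J B).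
Proof.
move=> T_bc; have [cl_typ cl_re] := closure_embeds (unif_merge f A J B) T_bc.
split=> [i p t _ tA|i j p q _ _ xy]; last by apply: cl_re => //; left.
have [t' + le_tt'] : exists2 t', typ (unif_merge f A J B) (i, p) = Some t' & (t <= t')%O.
  by rewrite /= tA; case: ifP => _; [apply: le_ojoinl | exists t].
by move/cl_typ => [//|u ? le_t'u]; exists u => //; apply: le_trans le_t'u.
Qed.

Lemma unif_embedsr f A J B : bounded_complete T -> embeds f J B (unif f A J B).
Proof.
move=> T_bc; have [cl_typ cl_re] := closure_embeds (unif_merge f A J B) T_bc.
split=> [i p t Ji tB|i j p q Ji Jj xy]; last by apply: cl_re => //; right.
have [t' + le_tt'] : exists2 t', typ (unif_merge f A J B) (i, p) = Some t' & (t <= t')%O.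
  by rewrite /= tB Ji; apply: le_ojoinr.
by move/cl_typ => [//|u ? le_t'u]; exists u => //; apply: le_trans le_t'u.
Qed.

Section ClosureAmrs.
Variables (X : pre_amrs F T).
Hypotheses (X_index : forall x, paths X x -> 1 <= x.1 <= len X)
  (X_root : forall i, 1 <= i <= len X -> paths X (i, [::]))
  (X_prefix : forall x a, paths X (ext x a) -> paths X x)
  (X_reent : forall x y, reent X x y -> paths X x /\ paths X y).

(** All paths with an index of [X], any two of them related, form a closed extension. *)
Lemma cl_index x : cl_paths X x -> 1 <= x.1 <= len X.
Proof.
move/(_ [set x | 1 <= x.1 <= len X]
  (fun x y => (1 <= x.1 <= len X) /\ (1 <= y.1 <= len X))); apply; split=> //.
by move=> u v /X_reent[/X_index ? /X_index ?].
Qed.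

(** By minimality: [cl_reent] restricted to [cl_paths] still gives a closed extension. *)
Lemma cl_reent_paths x y : cl_reent X x y -> cl_paths X x /\ cl_paths X y.
Proof.
have [Psub Esub Ppre Pfus] := cl_closed X.
move/(_ (cl_paths X) (fun x y => [/\ cl_paths X x, cl_paths X y & cl_reent X x y])).
case=> //; split=> // [u v uv|i p a i' p' a' Pa Pa' [_ _ E0]].
  by have [/Psub ? /Psub ?] := X_reent uv; split=> //; apply: Esub.
by case: (Pfus _ _ _ _ _ _ Pa Pa' E0); split.
Qed.

Let R x y := reent (closure X) x y.

Let R_equiv : equivalence_on (cl_paths X) R.
Proof. exact: eq_Cl_equivalence cl_reent_paths. Qed.

Lemma cl_prefix x a : cl_paths X (ext x a) -> cl_paths X x.
Proof. by case: (cl_closed X) => _ _ H _; case: x => i p; apply: H. Qed.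

(** Fusion is known for [cl_reent], while [R] is the equivalence generated by it. The relation [E]
    below is an equivalence containing [cl_reent], hence contains [R]; it has one implication for
    each side in order to be symmetric. *)
Lemma closure_fusion x y a : R x y -> cl_paths X (ext y a) -> R (ext x a) (ext y a).
Proof.
have [RP Rrefl Rsym Rtrans] := R_equiv; have [_ _ _ Pfus] := cl_closed X.
have Rsub u v : cl_reent X u v -> R u v by move=> uv E _; apply.
have stepr u v b : cl_reent X u v -> cl_paths X (ext v b) -> R (ext u b) (ext v b).
  move=> uv vb; have [Pu Pv] := cl_reent_paths uv; move: u v uv vb Pu Pv.
  move=> [i p] [j q] uv vb Pu Pv.
  by have := Pfus i p [::] j q b; rewrite !cats0 => /(_ Pu vb uv)[_ _ /Rsub].
have stepl u v b : cl_reent X u v -> cl_paths X (ext u b) -> R (ext u b) (ext v b).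
  move=> uv ub; have [Pu Pv] := cl_reent_paths uv; move: u v uv ub Pu Pv.
  move=> [i p] [j q] uv ub Pu Pv.
  by have := Pfus i p b j q [::]; rewrite !cats0 => /(_ ub Pv uv)[_ _ _ /Rsub/Rsym].
pose E u v := [/\ cl_paths X u, cl_paths X v & forall b,
  (cl_paths X (ext u b) -> R (ext u b) (ext v b)) /\
  (cl_paths X (ext v b) -> R (ext u b) (ext v b))].
move=> xy; suff /xy[|_ _ /(_ a)[_ +]] : equivalence_on (paths (Cl X)) E.
- move=> u v uv; have [Pu Pv] := cl_reent_paths uv.
  by split=> // b; split; [apply: stepl | apply: stepr].
- exact.
rewrite paths_Cl; split.
- by move=> u v [].
- by move=> u Pu; split=> // b; split=> /Rrefl.
- by move=> u v [Pu Pv uv]; split=> // b; case: (uv b) => uvl uvr; split=> [/uvr|/uvl] /Rsym.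
- move=> u v w [Pu Pv uv] [_ Pw vw]; split=> // b.
  case: (uv b) (vw b) => uvl uvr [vwl vwr]; split.
    by move/uvl => E1; have [_ /vwl] := RP _ _ E1; apply: Rtrans.
  by move/vwr => E1; have [/uvr + _] := RP _ _ E1; move/Rtrans; apply.
Qed.

(* Closing under prefixes and fusion only adds paths equivalent to old ones, so
   it does not create new classes. *)
Lemma cl_paths_reps x : cl_paths X x -> exists2 y, paths X y & R x y.
Proof.
have [RP Rrefl Rsym Rtrans] := R_equiv; have [Psub Esub Ppre Pfus] := cl_closed X.
(* All prefixes of [u] are included because a closed extension has to be prefix-closed. *)
pose P u := cl_paths X u /\ forall v b, u = ext v b -> exists2 y, paths X y & R v y.
suff Pcl : closed_extension X P (cl_reent X).
  by move=> /(_ _ _ Pcl)[_ /(_ x [::])]; apply; rewrite ext_nil.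
(* A prefix of [ext u a'] is a prefix of [u] or some [ext u c]; the latter is equivalent to the
   prefix [ext v c] of [ext v a']. *)
have key u v a a' : P (ext u a) -> P (ext v a') -> R u v -> cl_paths X (ext u a') ->
    P (ext u a').
  move=> [_ Pua] [Pva' repva'] uv Pua'; split=> // -[i r] b [<-] /cat_eqP[[c urc _]|[c rc a'c]].
    by apply: Pua; rewrite /ext urc -catA.
  have vc : cl_paths X (ext v c) by apply: (@cl_prefix _ b); rewrite ext_cat -a'c.
  have E1 := closure_fusion uv vc.
  have [y Xy vy] : exists2 y, paths X y & R (ext v c) y.
    by apply: (repva' _ b); rewrite ext_cat -a'c.
  by exists y => //; rewrite rc; apply: Rtrans E1 vy.
split=> //.
- move=> u Xu; split; first exact: Psub.
  move=> v b uE; rewrite uE in Xu; have Xv := X_prefix Xu.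
  by exists v => //; apply: Rrefl; apply: Psub.
- move=> i p a [/Ppre Pip rep]; split=> // v b uE.
  by apply: (rep v (b ++ a)); rewrite -ext_cat -uE.
- move=> i p a i' p' a' Pa Pa' E0; have [Ppa _] := Pa; have [Pp'a' _] := Pa'.
  have [H1 H2 H3 H4] := Pfus _ _ _ _ _ _ Ppa Pp'a' E0.
  have R0 : R (i, p) (i', p') by move=> E _; apply.
  split=> //; first exact: (key (i, p) (i', p') a a').
  exact: (key (i', p') (i, p) a' a Pa' Pa (Rsym _ _ R0)).
Qed.

Lemma closure_typ_eq x y : R x y -> typ (closure X) x = typ (closure X) y.
Proof.
have [RP _ Rsym Rtrans] := R_equiv.
move=> xy; have [] := RP _ _ xy; rewrite -paths_Cl !typ_closure => -[s ->] [t ->] /=.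
congr (Some (lub _)); rewrite predeqE => u; split=> -[z zx tz]; exists z => //.
  exact: Rtrans zx xy.
exact: Rtrans zx (Rsym _ _ xy).
Qed.

(** By [cl_paths_reps] every class of the closure meets [X], so a finite cover of [X] by cliques of
    [R] becomes one of the closure after saturation. *)
Lemma closure_amrs (Y : eqType) (s : seq Y) (K : Y -> set (ipath F)) :
  (forall x, paths X x -> exists2 k, k \in s & K k x) ->
  (forall k x y, paths X x -> paths X y -> K k x -> K k y -> R x y) ->
  is_amrs (closure X).
Proof.
move=> cover clique; have [RP Rrefl Rsym Rtrans] := R_equiv.
pose K' k x := exists2 y, paths X y & R x y /\ K k y.
apply: (@is_amrsI _ _ s K'); rewrite ?paths_closure //.
- exact: cl_index.
- by move=> i /X_root Xi; case: (cl_closed X) => + _ _ _; apply.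
- exact: cl_prefix.
- exact: closure_fusion.
- by move=> x /cl_paths_reps[y Xy xy]; have [k sk ky] := cover _ Xy; exists k => //; exists y.
- move=> k x y _ _ [x' Xx' [xx' kx']] [y' Xy' [yy' ky']].
  exact: Rtrans (Rtrans _ _ _ xx' (clique _ _ _ Xx' Xy' kx' ky')) (Rsym _ _ yy').
- exact: closure_typ_eq.
Qed.

End ClosureAmrs.

Lemma unif_amrs f A (J : pred nat) B : bounded_complete T -> is_amrs A -> is_amrs B ->
  (forall i, J i -> 1 <= i <= len A) -> is_amrs (unif f A J B).
Proof.
move=> T_bc A_amrs B_amrs J_index; set X := unif_merge f A J B.
have XP x : paths X x <-> paths A x \/ J x.1 /\ paths B (f x.1, x.2).
  rewrite /paths /X /= ; case: (J x.1); last by split=> [|[|[]]] //; left.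
  case: (typ A x) (typ B _) => [t|] [u|] /=; split=> // [[? _]|[[? ]|[_ [? ]]]] //;
    by eauto.
have [sA coverA] := amrs_reps A_amrs; have [sB coverB] := amrs_reps B_amrs.
have X_index x : paths X x -> 1 <= x.1 <= len X.
  by case/XP => [/(amrs_index A_amrs)|[/J_index]].
have X_reent x y : reent X x y -> paths X x /\ paths X y.
  case=> [/(amrs_paths A_amrs)[xA yA]|[Jx Jy /(amrs_paths B_amrs)[xB yB]]].
    by split; apply/XP; left.
  by split; apply/XP; right.
have [_ _ Rsym Rtrans] : equivalence_on (cl_paths X) (reent (closure X)).
  exact: eq_Cl_equivalence (cl_reent_paths X_reent).
have RX x y : reent X x y -> reent (closure X) x y.
  by case: x y => i p [j q] xy; have [_] := closure_embeds X T_bc; apply.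
(* The pieces are the classes of [A] and the preimages under [f] of the classes of [B]; the closure
   can merge them but not split them. *)
pose K (k : ipath F + ipath F) x := match k with
  | inl y => reent A x y
  | inr y => J x.1 /\ reent B (f x.1, x.2) y end.
apply: (@closure_amrs _ X_index _ _ X_reent _ (map inl sA ++ map inr sB) K).
- by move=> i /(amrs_root A_amrs) iA; apply/XP; left.
- move=> x a /XP[/(amrs_prefix A_amrs)|[Jx /(@amrs_prefix _ B_amrs (_, _)) xB]].
    by move=> xA; apply/XP; left.
  by apply/XP; right.
- move=> x /XP[/coverA[y sy xy]|[Jx /coverB[y sy xy]]].
    by exists (inl y) => //; rewrite mem_cat map_f.
  by exists (inr y) => //; rewrite mem_cat orbC map_f.
- move=> [z|z] x y _ _ /=.
    move=> xz yz; apply: RX; left; apply: amrs_trans xz _ => //; exact: amrs_sym.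
  move=> [Jx xz] [Jy yz]; apply: RX; right; split=> //.
  apply: amrs_trans xz _ => //; exact: amrs_sym.
Qed.

(** Subsumption of A^a and B^b, with both elements left in place so that nothing is renumbered.
    Inclusion of paths is contained in the clause on types. *)
Definition le_at A a B b :=
  (forall p t, typ A (a, p) = Some t ->
     exists2 t', typ B (b, p) = Some t' & (t <= t')%O) /\
  (forall p q, reent A (a, p) (a, q) -> reent B (b, p) (b, q)).

Lemma le_at_trans A a B b X c : le_at A a B b -> le_at B b X c -> le_at A a X c.
Proof.
move=> [At Ar] [Bt Br]; split=> [p t /At[u /Bt[v Xv uv] tu]|p q /Ar/Br //].
by exists v => //; apply: le_trans uv.
Qed.

Lemma le_at_refl A a : le_at A a A a.
Proof. by split=> // p t; exists t. Qed.

Lemma le_at_paths A a B b p : le_at A a B b -> paths A (a, p) -> paths B (b, p).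
Proof. by move=> [H _] [t /H[u ? _]]; exists u. Qed.

Lemma embeds_le_at f (J : pred nat) A B i : embeds f J B A -> J i -> le_at B (f i) A i.
Proof. by move=> [Ht Hr] Ji; split=> [p t|p q]; [apply: Ht | apply: Hr]. Qed.

Lemma elt_le_at A a : le_at (elt A a) 1 A a.
Proof.
rewrite /elt /sub subSnn; split=> [p t|p q] /=; first by rewrite add1n subn1; exists t.
by rewrite add1n subn1 => -[].
Qed.

Lemma le_at_elt A a : le_at A a (elt A a) 1.
Proof.
rewrite /elt /sub subSnn; split=> [p t|p q] /=; first by rewrite add1n subn1; exists t.
by rewrite add1n subn1.
Qed.

Lemma le_at_sub A a k : 0 < a -> a <= k -> le_at A a (sub A 1 k) a.
Proof.
move=> a0 ak; split=> [p t|p q] /=; rewrite addn1 subn1 /= ?subn1 /= a0 ak //.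
by exists t.
Qed.

(** * Specializing a rule to a given head *)

Section Glue.
Variables (C Z : pre_amrs F T) (m l : nat).
Hypotheses (C_amrs : is_amrs C) (Z_amrs : is_amrs Z)
  (m_index : 1 <= m <= len C) (leCZ : le_at C m Z l).

(** The prefix [p1] meets the head of [C] at [q1], and the rest [p2] is followed inside Z^l,
    possibly beyond the paths of [C]. The result [q] is determined only up to reentrancy in [Z]. *)
Definition via x q := exists p1 p2 q1,
  [/\ x.2 = p1 ++ p2, q = q1 ++ p2, reent C (x.1, p1) (m, q1) & paths Z (l, q)].

(* The pushout of C and Z^l over C^m: [via x q] says that x leads to the path q
   of Z^l. *)
Definition glue : pre_amrs F T := PreAmrs (len C)
  (fun x => if `[< via x !=set0 >] then typ Z (l, xget [::] (via x)) else typ C x)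
  (fun x y => reent C x y \/
     exists q q', [/\ via x q, via y q' & reent Z (l, q) (l, q')]).

Lemma via_paths x q : via x q -> paths Z (l, q).
Proof. by case=> p1 [p2 [q1 []]]. Qed.

(** Of two splittings of [x], consider the one with the longer prefix. At its end both head paths
    are equivalent in [C], hence in [Z] by [leCZ], and fusion in [Z] appends the remainder. *)
Lemma via_uniq x q q' : via x q -> via x q' -> reent Z (l, q) (l, q').
Proof.
have main p1 q1 r q1' p2 : reent C (x.1, p1) (m, q1) ->
    reent C (x.1, p1 ++ r) (m, q1') -> paths Z (l, q1' ++ p2) ->
    reent Z (l, q1 ++ r ++ p2) (l, q1' ++ p2).
  move=> H1 H2 Zq; have [_ leC] := leCZ.
  have [C1 _] := amrs_paths C_amrs H2.
  have H3 := amrs_fusion C_amrs (amrs_sym C_amrs H1) C1.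
  have := leC _ _ (amrs_trans C_amrs H3 H2).
  by move/(amrs_fusion Z_amrs) => /(_ _ Zq); rewrite /ext /= -catA.
move=> [p1 [p2 [q1 [xp -> H1 Zq]]]] [p1' [p2' [q1' [xp' -> H1' Zq']]]].
have /cat_eqP[[c p1E p2'E]|[c p1'E p2E]] : p1 ++ p2 = p1' ++ p2' by rewrite -xp -xp'.
  rewrite p1E in H1; rewrite p2'E; apply: amrs_sym => //; exact: main H1' H1 Zq.
by rewrite p1'E in H1'; rewrite p2E; exact: main H1 H1' Zq'.
Qed.

Lemma via_ext x a q : via x q -> paths Z (l, q ++ a) -> via (ext x a) (q ++ a).
Proof.
move=> [p1 [p2 [q1 [xp qE H _]]]] Zq; exists p1, (p2 ++ a), q1.
by split=> //=; rewrite ?xp ?qE catA.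
Qed.

(** The splitting point lies either in [y] or in [a]. *)
Lemma via_extP y a q : via (ext y a) q ->
  (exists2 q0, q = q0 ++ a & via y q0) \/
  (exists r p2 q1, [/\ a = r ++ p2, q = q1 ++ p2 & reent C (ext y r) (m, q1)]).
Proof.
move=> [p1 [p2 [q1 [/cat_eqP[[c yp p2E]|[c p1E aE]] qE H Zq]]]].
  left; exists (q1 ++ c); first by rewrite qE p2E catA.
  exists p1, c, q1; split=> //.
  by apply: (@amrs_prefix _ Z_amrs (l, q1 ++ c) a); rewrite /ext -catA -p2E -qE.
by right; exists c, p2, q1; split=> //; rewrite /ext -p1E.
Qed.

Lemma via_shift x y a q : reent C x y -> via (ext y a) q -> via (ext x a) q.
Proof.
move=> xy yaq; have Zq := via_paths yaq.
case: (yaq) => p1 [p2 [q1 [/cat_eqP[[c yp p2E]|[c p1E aE]] qE H _]]].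
  have Cy : paths C (ext (y.1, p1) c).
    by rewrite /ext /= -yp; have [_] := amrs_paths C_amrs xy; case: (y).
  have H1 := amrs_fusion C_amrs (amrs_sym C_amrs H) Cy.
  rewrite /ext /= -yp -(surjective_pairing y) in H1.
  have H2 := amrs_trans C_amrs xy (amrs_sym C_amrs H1).
  exists x.2, a, (q1 ++ c); split=> //; first by rewrite qE p2E catA.
  by rewrite -(surjective_pairing x).
have Cy : paths C (ext y c) by rewrite /ext -p1E; have [] := amrs_paths C_amrs H.
have H1 := amrs_fusion C_amrs xy Cy.
exists (x.2 ++ c), p2, q1; split=> //; first by rewrite /= aE catA.
by apply: (amrs_trans C_amrs H1); rewrite /ext -p1E.
Qed.

Lemma via_reent x y q : reent C x y -> via y q -> via x q.
Proof. by move=> xy; rewrite -[x]ext_nil -[y in via y]ext_nil; apply: via_shift. Qed.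

Lemma paths_glue x : paths glue x <-> paths C x \/ via x !=set0.
Proof.
rewrite /paths /=; case: asboolP => [xq|xq]; split; [by right | | by left | by case].
by move=> _; apply: (@via_paths x); apply: (@xgetPex _ [::] (via x)).
Qed.

Lemma typ_glue_via x q : via x q -> typ glue x = typ Z (l, q).
Proof.
move=> xq /=; case: asboolP => [[q' xq']|[]]; last by exists q.
apply: (amrs_typ Z_amrs); apply: via_uniq xq.
by apply: (@xgetPex _ [::] (via x)); exists q'.
Qed.

Lemma typ_glue_nvia x : ~ (via x !=set0) -> typ glue x = typ C x.
Proof. by rewrite /=; case: asboolP. Qed.

(** This is what fusion for [glue] needs. If [ext y a] is a path of [C], so is its counterpart in
    the head, which [leCZ] carries to [Z]. Otherwise [ext y a] leads into [Z]; if it meets the head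
    only at some [ext y r], then [via_uniq] identifies [q ++ r] with [q1], and fusion appends the
    rest. *)
Lemma via_ext_paths y q a : via y q -> paths glue (ext y a) -> paths Z (l, q ++ a).
Proof.
have main b q0 : via y q0 -> paths C (ext y b) -> paths Z (l, q0 ++ b).
  move=> [p1 [p2 [q1 [yp -> H _]]]] yb.
  have Cb : paths C (ext (y.1, p1) (p2 ++ b)) by rewrite /ext /= catA -yp.
  have H1 := amrs_fusion C_amrs (amrs_sym C_amrs H) Cb.
  have [Cm _] := amrs_paths C_amrs H1; rewrite -catA.
  exact: le_at_paths leCZ Cm.
move=> yq /paths_glue[/(main _ _ yq) //|[q'' yaq'']].
have Zq'' := via_paths yaq''; case: (via_extP yaq'') => [[q0 qE yq0]|].
  rewrite qE in Zq''; have := amrs_fusion Z_amrs (via_uniq yq yq0) Zq''.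
  by case/(amrs_paths Z_amrs).
move=> [r [p2 [q1 [aE qE H]]]].
have [Cyr _] := amrs_paths C_amrs H; rewrite qE in Zq''.
have yr := via_ext yq (main _ _ yq Cyr).
have yr' : via (ext y r) q1.
  exists (y.2 ++ r), [::], q1; split; rewrite ?cats0 //.
  exact: (@amrs_prefix _ Z_amrs (l, q1) p2).
have := amrs_fusion Z_amrs (via_uniq yr yr') Zq''.
by rewrite aE catA; case/(amrs_paths Z_amrs).
Qed.

(** The union of the two relations is already transitive: a step in [C] preserves the paths led to
    ([via_reent]), and two steps in [Z] compose by [via_uniq]. *)
Lemma glue_equivalence : equivalence_on (paths glue) (reent glue).
Proof.
split.
- move=> x y [/(amrs_paths C_amrs)[]|[q [q' [xq yq' _]]]].
    by move=> Cx Cy; split; apply/paths_glue; left.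
  by split; apply/paths_glue; right; [exists q | exists q'].
- move=> x /paths_glue[Cx|[q xq]]; first by left; apply: amrs_refl.
  by right; exists q, q; split=> //; apply: amrs_refl => //; apply: via_paths xq.
- move=> x y [xy|[q [q' [xq yq' qq']]]]; first by left; apply: amrs_sym.
  by right; exists q', q; split=> //; apply: amrs_sym.
- move=> x y z [xy|[q [q' [xq yq' qq']]]] [yz|[q1 [q1' [yq1 zq1' q1q1']]]].
  + by left; apply: amrs_trans yz.
  + by right; exists q1, q1'; split=> //; apply: via_reent yq1.
  + by right; exists q, q'; split=> //; apply: via_reent yq' => //; apply: amrs_sym.
  + right; exists q, q1'; split=> //; apply: (amrs_trans Z_amrs qq').
    exact: amrs_trans (via_uniq yq' yq1) q1q1'.
Qed.

Lemma glue_amrs : is_amrs glue.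
Proof.
have [sC coverC] := amrs_reps C_amrs; have [sZ coverZ] := amrs_reps Z_amrs.
pose K (k : ipath F + ipath F) x := match k with
  | inl y => reent C x y
  | inr y => exists2 q, via x q & reent Z (l, q) y end.
apply: (@is_amrsI _ _ (map inl sC ++ map inr sZ) K).
- move=> x /paths_glue[/(amrs_index C_amrs) //|[q [p1 [p2 [q1 [_ _ H _]]]]]].
  by have [/(amrs_index C_amrs)] := amrs_paths C_amrs H.
- by move=> i /(amrs_root C_amrs) iC; apply/paths_glue; left.
- move=> x a /paths_glue[/(amrs_prefix C_amrs) xC|[q /via_extP]].
    by apply/paths_glue; left.
  case=> [[q0 _ xq0]|[r [p2 [q1 [_ _ H]]]]]; apply/paths_glue; first by right; exists q0.
  by left; have [/(amrs_prefix C_amrs)] := amrs_paths C_amrs H.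
- exact: glue_equivalence.
- move=> x y a [xy|[q [q' [xq yq' qq']]]] Uya.
    case/paths_glue: (Uya) => [Cya|[q yaq]]; first by left; apply: amrs_fusion.
    right; exists q, q; split=> //; first exact: via_shift yaq.
    by apply: amrs_refl => //; apply: via_paths yaq.
  have Zq'a := via_ext_paths yq' Uya.
  have H := amrs_fusion Z_amrs qq' Zq'a.
  right; exists (q ++ a), (q' ++ a); split=> //; apply: via_ext => //.
  by case: (amrs_paths Z_amrs H).
- move=> x /paths_glue[/coverC[y sy xy]|[q xq]].
    by exists (inl y) => //; rewrite mem_cat map_f.
  have [y sy qy] := coverZ _ (via_paths xq).
  by exists (inr y); [rewrite mem_cat orbC map_f | exists q].
- move=> [z|z] x y _ _ /=.
    move=> xz yz; left; apply: amrs_trans xz _ => //; exact: amrs_sym.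
  move=> [q xq qz] [q' yq' q'z]; right; exists q, q'; split=> //.
  apply: amrs_trans qz _ => //; exact: amrs_sym.
- move=> x y [xy|[q [q' [xq yq' qq']]]].
    have [[q xq]|nx] := EM (via x !=set0).
      rewrite (typ_glue_via xq) (@typ_glue_via y q) //.
      by apply: via_reent xq; apply: amrs_sym.
    rewrite !typ_glue_nvia //; first exact: (amrs_typ C_amrs).
    by move=> [q yq]; apply: nx; exists q; apply: via_reent yq.
  by rewrite (typ_glue_via xq) (typ_glue_via yq'); apply: (amrs_typ Z_amrs).
Qed.

Lemma glue_top_free : top_free C -> top_free Z -> top_free glue.
Proof. by move=> Ct Zt x /=; case: asboolP => _; [apply: Zt | apply: Ct]. Qed.

(** Where a path of [C] takes its type from [Z], it is equivalent in [C] to a head path, whose type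
    [leCZ] bounds by that in [Z]. Hence no join is taken. *)
Lemma embeds_glue : embeds id predT C glue.
Proof.
split=> [i p t _ Ct|]; last by move=> *; left.
have [[q xq]|nx] := EM (via (i, p) !=set0); last first.
  by exists t => //; rewrite typ_glue_nvia.
rewrite (typ_glue_via xq); case: (xq) => p1 [p2 [q1 [/= pE -> H _]]].
have Cp : paths C (ext (i, p1) p2) by rewrite /ext /= -pE; exists t.
have H1 := amrs_fusion C_amrs (amrs_sym C_amrs H) Cp.
by case: leCZ => + _; apply; rewrite -Ct pE; apply: amrs_typ H1.
Qed.

Lemma via_diag p : paths Z (l, p) -> via (m, p) p.
Proof.
move=> Zp; exists [::], p, [::]; split=> //.
by apply: amrs_refl => //; apply: amrs_root.
Qed.

Lemma via_diag_paths p q : via (m, p) q -> paths Z (l, p).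
Proof.
move=> [p1 [p2 [q1 [/= -> qE H Zq]]]]; case: leCZ => _ /(_ _ _ H) H1.
by rewrite qE in Zq; have := amrs_fusion Z_amrs H1 Zq; case/(amrs_paths Z_amrs).
Qed.

(** On the head, [via] is the identity up to reentrancy in [Z], so gluing in [C] adds nothing to
    Z^l. *)
Lemma elt_glue : elt glue m = elt Z l.
Proof.
have typE p : typ glue (m, p) = typ Z (l, p).
  have [Zp|nZp] := EM (paths Z (l, p)); first exact: typ_glue_via (via_diag Zp).
  rewrite typ_glue_nvia; last by move=> [q /via_diag_paths].
  case E : (typ Z _) => [t|]; first by case: nZp; exists t.
  case E' : (typ C _) => [t|] //.
  by case: nZp; apply: (le_at_paths leCZ); exists t.
have reentE p q : reent glue (m, p) (m, q) <-> reent Z (l, p) (l, q).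
  split=> [[|[p' [q' [pp' qq' H]]]]|H]; first by case: leCZ => _; apply.
    have pp := via_diag (via_diag_paths pp'); have qq := via_diag (via_diag_paths qq').
    apply: (amrs_trans Z_amrs) (via_uniq qq' qq).
    exact: (amrs_trans Z_amrs) (via_uniq pp pp') H.
  have [Zp Zq] := amrs_paths Z_amrs H.
  by right; exists p, q; split=> //; apply: via_diag.
rewrite /elt /sub !subSnn; apply: pre_amrs_ext => // [[i p]|[i p] [j q]].
  rewrite [LHS]/= [RHS]/=; case: ifP => // /andP[i1 i2].
  have -> : i = 1 by lia.
  by rewrite [1 + m]add1n [1 + l]add1n !subn1; apply: typE.
move=> /=; split=> -[i1 j1]; have [-> ->] : i = 1 /\ j = 1 by lia.
  by rewrite [1 + m]add1n [1 + l]add1n !subn1 => /reentE.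
by rewrite [1 + m]add1n [1 + l]add1n !subn1 => /reentE.
Qed.

End Glue.

Lemma elt_eqP A a B b : elt A a = elt B b ->
  (forall p, typ A (a, p) = typ B (b, p)) /\
  (forall p q, reent A (a, p) (a, q) <-> reent B (b, p) (b, q)).
Proof.
rewrite /elt /sub !subSnn => -[/funeqP tE rE]; split=> [p|p q].
  by have := tE (1, p); rewrite /= ![1 + _]add1n !subn1.
have := congr1 (fun r => r (1, p) (1, q)) rE.
rewrite /= ![1 + _]add1n !subn1 /= => H; split=> h.
  have : [/\ 0 < 1, 0 < 1 & reent A (a, p) (a, q)] by [].
  by rewrite H => -[].
have : [/\ 0 < 1, 0 < 1 & reent B (b, p) (b, q)] by [].
by rewrite -H => -[].
Qed.

(** * Replacing an element by the body of a rule *)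

Section Replace.
Variables (Z R : pre_amrs F T) (j : nat).
Hypotheses (Z_amrs : is_amrs Z) (R_amrs : is_amrs R) (R_len : 0 < len R)
  (j_index : 1 <= j <= len Z) (ZR : elt Z j = elt R (len R)).
Let m := len R.

(* The replacement of Z^j by the body of R is a part of the amalgam of Z and R
   over Z^j = R^m, whose paths are tagged by the side from which they come. *)
Definition amalgam (s t : ipath F + ipath F) : Prop :=
  match s, t with
  | inl x, inl y => reent Z x y
  | inr x, inr y => reent R x y
  | inl x, inr y | inr y, inl x =>
      exists p, reent Z x (j, p) /\ reent R (m, p) y
  end.

(** Inverts [repl_f] (on the left) and [repl_g] (on the right). The interface, element [j] of [Z]
    and head of [R], is not hit. *)
Definition tag (x : ipath F) : ipath F + ipath F :=
  let: (l, p) := x in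
  if l < j then inl (l, p)
  else if l < j + m - 1 then inr (l + 1 - j, p) else inl (l + 2 - m, p).

Definition tag_typ (s : ipath F + ipath F) :=
  match s with inl x => typ Z x | inr x => typ R x end.

Definition tag_ext (s : ipath F + ipath F) a :=
  match s with inl x => inl (ext x a) | inr x => inr (ext x a) end.

Lemma typ_replace x : typ (replace Z j R) x = tag_typ (tag x).
Proof. by case: x => l p /=; rewrite -/m; case: ifP => // _; case: ifP. Qed.

Lemma tag_extE x a : tag (ext x a) = tag_ext (tag x) a.
Proof. by case: x => l p /=; case: ifP => // _; case: ifP. Qed.

Lemma tagP x :
  (exists i p, [/\ i <> j, x = (repl_f j m i, p) & tag x = inl (i, p)]) \/
  (exists i p, [/\ 0 < i < m, x = (repl_g j i, p) & tag x = inr (i, p)]).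
Proof.
case: x => l p /=; rewrite /repl_f /repl_g; case: ifP => lj.
  by left; exists l, p; rewrite lj; split=> //; lia.
case: ifP => ljm.
  by right; exists (l + 1 - j), p; split=> //; try congr (_, _); lia.
left; exists (l + 2 - m), p.
have -> : (l + 2 - m < j) = false by lia.
by split=> //; try congr (_, _); lia.
Qed.

Lemma tag_f i p : i <> j -> tag (repl_f j m i, p) = inl (i, p).
Proof.
move=> ij; rewrite /repl_f; have [ji|ji] := ltnP i j; first by rewrite /= ji.
rewrite /=.
rewrite ifF; last by lia.
rewrite ifF; last by lia.
by congr (inl (_, _)); lia.
Qed.

Lemma tag_g i p : 0 < i < m -> tag (repl_g j i, p) = inr (i, p).
Proof.
move=> im; rewrite /repl_g /=.
rewrite ifF; last by lia.
rewrite ifT; last by lia.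
by congr (inr (_, _)); lia.
Qed.

Lemma reent_replace x y : reent (replace Z j R) x y <-> amalgam (tag x) (tag y).
Proof.
(* The clauses of [replace] bound the indices of [R] only from above; positivity comes from their
   occurring in a reentrancy of [R]. *)
have R0 i p z : reent R (i, p) z \/ reent R z (i, p) -> 0 < i.
  by case=> /(amrs_paths R_amrs)[] => [/(amrs_index R_amrs)/andP[] //|_
    /(amrs_index R_amrs)/andP[]].
split=> /=; rewrite -/m.
- case=> [[i1 [i2 [p1 [p2 [n1 n2 -> -> H]]]]]|[i1 [i2 [p1 [p2 [n1 n2 -> -> H]]]]]|].
  + by rewrite !tag_f.
  + by rewrite !tag_g // ?n1 ?n2 andbT; apply: R0; [right | left]; apply: H.
  + move=> [i1 [i2 [p1 [p2 [n1 n2 xy [p3 [H1 H2]]]]]]].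
    have n2' : 0 < i2 < m by rewrite n2 andbT; apply: R0; right; apply: H2.
    by case: xy => -[-> ->]; rewrite tag_f // tag_g //=; exists p3.
- case: (tagP x) (tagP y) => [[i1 [p1 [n1 xE ->]]]|[i1 [p1 [n1 xE ->]]]];
    case=> [[i2 [p2 [n2 yE ->]]]|[i2 [p2 [n2 yE ->]]]] /= H.
  + by apply: Or31; exists i1, i2, p1, p2.
  + apply: Or33; exists i1, i2, p1, p2; split=> //; [by case/andP: n2 | by left].
  + apply: Or33; exists i2, i1, p2, p1; split=> //; [by case/andP: n1 | by right].
  + apply: Or32; exists i1, i2, p1, p2; split=> //; [by case/andP: n1 | by case/andP: n2].
Qed.

Let tE : forall p, typ Z (j, p) = typ R (m, p).
Proof. by case: (elt_eqP ZR). Qed.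

Let rE : forall p q, reent Z (j, p) (j, q) <-> reent R (m, p) (m, q).
Proof. by case: (elt_eqP ZR). Qed.

Lemma amalgam_typ s t : amalgam s t -> tag_typ s = tag_typ t.
Proof.
case: s t => x [] y /=.
- exact: amrs_typ.
- by move=> [p [/(amrs_typ Z_amrs) -> /(amrs_typ R_amrs) <-]]; apply: tE.
- by move=> [p [/(amrs_typ Z_amrs) -> /(amrs_typ R_amrs) <-]]; rewrite tE.
- exact: amrs_typ.
Qed.

Lemma amalgam_paths s t : amalgam s t ->
  (exists u, tag_typ s = Some u) /\ (exists u, tag_typ t = Some u).
Proof.
case: s t => x [] y /=.
- exact: amrs_paths.
- by move=> [p [/(amrs_paths Z_amrs)[? _] /(amrs_paths R_amrs)[_ ?]]].
- by move=> [p [/(amrs_paths Z_amrs)[? _] /(amrs_paths R_amrs)[_ ?]]].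
- exact: amrs_paths.
Qed.

Lemma amalgam_refl s u : tag_typ s = Some u -> amalgam s s.
Proof. by case: s => x xu /=; apply: amrs_refl => //; exists u. Qed.

Lemma amalgam_sym s t : amalgam s t -> amalgam t s.
Proof. by case: s t => x [] y //=; apply: amrs_sym. Qed.

(** A chain that changes sides twice crosses the interface at two paths; by [rE] their equivalence
    on one side is equivalence on the other. *)
Lemma amalgam_trans s t u : amalgam s t -> amalgam t u -> amalgam s u.
Proof.
have Zt := amrs_trans Z_amrs; have Rt := amrs_trans R_amrs.
have Zs := amrs_sym Z_amrs; have Rs := amrs_sym R_amrs.
case: s t u => x [] y [] z /=.
- exact: Zt.
- by move=> xy [p [yp pz]]; exists p; split=> //; apply: Zt yp.
- move=> [p [xp py]] [q [zq qy]]; apply: (Zt _ _ _ xp); apply: Zt (Zs _ _ zq).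
  by apply/rE; apply: Rt py (Rs _ _ qy).
- by move=> [p [xp py]] yz; exists p; split=> //; apply: Rt yz.
- by move=> [p [yp px]] yz; exists p; split=> //; apply: Zt yp; apply: Zs.
- move=> [p [yp px]] [q [yq qz]]; apply: (Rt _ _ _ (Rs _ _ px)); apply: Rt qz.
  by apply/rE; apply: Zt (Zs _ _ yp) yq.
- by move=> xy [p [zp py]]; exists p; split=> //; apply: Rt py (Rs _ _ xy).
- exact: Rt.
Qed.

Lemma amalgam_ext s t a u : amalgam s t -> tag_typ (tag_ext t a) = Some u ->
  amalgam (tag_ext s a) (tag_ext t a).
Proof.
case: s t => x [] y /=.
- by move=> xy ya; apply: amrs_fusion => //; exists u.
- move=> [p [xp py]] ya; have Rya : paths R (ext y a) by exists u.
  have H := amrs_fusion R_amrs py Rya; exists (p ++ a); split=> //.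
  (* The extended interface path is known in [R]; [tE] carries it over to [Z]. *)
  have Zpa : paths Z (ext (j, p) a).
    have [[v vE] _] := amrs_paths R_amrs H.
    by exists v; rewrite -vE; apply: tE.
  exact: (amrs_fusion Z_amrs xp Zpa).
- move=> [p [yp px]] ya; have Zya : paths Z (ext y a) by exists u.
  have H := amrs_fusion Z_amrs (amrs_sym Z_amrs yp) Zya.
  exists (p ++ a); split; first exact: (amrs_sym Z_amrs H).
  have Rpa : paths R (ext (m, p) a).
    have [[v vE] _] := amrs_paths Z_amrs H.
    by exists v; rewrite -vE; symmetry; apply: tE.
  by apply: amrs_sym => //; apply: amrs_fusion Rpa => //; apply: amrs_sym.
- by move=> xy ya; apply: amrs_fusion => //; exists u.
Qed.

(** The amalgam relation is already an equivalence closed under fusion. By [closure_id] the outcome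
    of the derivation step is thus the bare replacement. *)
Lemma replace_amrs : is_amrs (replace Z j R).
Proof.
have [sZ coverZ] := amrs_reps Z_amrs; have [sR coverR] := amrs_reps R_amrs.
pose K (k : ipath F + ipath F) x := amalgam (tag x) k.
have PE x : paths (replace Z j R) x <-> exists u, tag_typ (tag x) = Some u.
  by rewrite /paths /mkset typ_replace.
apply: (@is_amrsI _ _ (map inl sZ ++ map inr sR) K).
- move=> x /PE; rewrite [len _]/= -/m.
  case: (tagP x) => -[i [p [ij -> ->]]] [u /= tx].
    have /(amrs_index Z_amrs) /= : paths Z (i, p) by exists u.
    by rewrite /repl_f; case: ifP; lia.
  by rewrite /repl_g; lia.
- move=> i; rewrite [len _]/= -/m => i_index; apply/PE => /=.
  case: ifP => ij; first by apply: (amrs_root Z_amrs); lia.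
  by case: ifP => ijm; [apply: (amrs_root R_amrs) | apply: (amrs_root Z_amrs)]; lia.
- move=> x a /PE; rewrite tag_extE => H; apply/PE; case: (tag x) H => y /=.
    exact: amrs_prefix.
  exact: amrs_prefix.
- split.
  + by move=> x y /reent_replace/amalgam_paths[? ?]; split; apply/PE.
  + by move=> x /PE[u /amalgam_refl ?]; apply/reent_replace.
  + by move=> x y /reent_replace/amalgam_sym ?; apply/reent_replace.
  + move=> x y z /reent_replace xy /reent_replace yz; apply/reent_replace.
    exact: amalgam_trans yz.
- move=> x y a /reent_replace xy /PE[u]; rewrite tag_extE => ya; apply/reent_replace.
  by rewrite !tag_extE; apply: amalgam_ext ya.
- move=> x /PE[u]; rewrite /K; case: (tag x) => y /= yu.
    have [|k sk yk] := coverZ y; first by exists u.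
    by exists (inl k) => //; rewrite mem_cat map_f.
  have [|k sk yk] := coverR y; first by exists u.
  by exists (inr k) => //; rewrite mem_cat orbC map_f.
- move=> k x y _ _ xk yk; apply/reent_replace.
  exact: amalgam_trans xk (amalgam_sym yk).
- by move=> x y /reent_replace/amalgam_typ; rewrite !typ_replace.
Qed.

Lemma replace_top_free : top_free Z -> top_free R -> top_free (replace Z j R).
Proof.
by move=> Zt Rt x; rewrite typ_replace; case: (tag x) => y; [apply: Zt | apply: Rt].
Qed.

Lemma le_at_replace_f i : i <> j -> le_at Z i (replace Z j R) (repl_f j m i).
Proof.
move=> ij; split=> [p t Zt|p q H]; last by apply/reent_replace; rewrite !tag_f.
by exists t => //; rewrite typ_replace tag_f.
Qed.

Lemma le_at_replace_g i : 0 < i < m -> le_at R i (replace Z j R) (repl_g j i).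
Proof.
move=> im; split=> [p t Zt|p q H]; last by apply/reent_replace; rewrite !tag_g.
by exists t => //; rewrite typ_replace tag_g.
Qed.

(** At these positions [tag] points into the body of [R], where the amalgam relation is that of [R]
    itself. *)
Lemma sub_replace : 2 <= m -> sub (replace Z j R) j (j + m - 2) = sub R 1 (m - 1).
Proof.
move=> m2; have lE : (j + m - 2).+1 - j = (m - 1).+1 - 1 by lia.
apply: pre_amrs_ext => //= [[i p]|[i p] [i' q]] /=; rewrite lE.
  case: ifP => // im; apply: etrans (typ_replace (repl_g j i, p)) _.
  by rewrite tag_g ?addnK //; lia.
split=> -[i1 i2]; rewrite -/(repl_g j i) -/(repl_g j i') !addnK => H; split=> //.
  by have /reent_replace := H; rewrite !tag_g //; lia.
apply/reent_replace; rewrite !tag_g //; lia.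
Qed.

End Replace.

Lemma sub_amrs A j k : is_amrs A -> 0 < j -> k <= len A -> is_amrs (sub A j k).
Proof.
move=> A_amrs j0 kA; have [sA coverA] := amrs_reps A_amrs.
pose sh (x : ipath F) : ipath F := (x.1 + j - 1, x.2).
have PE x : paths (sub A j k) x <-> 1 <= x.1 <= k.+1 - j /\ paths A (sh x).
  by rewrite /paths /=; case: ifP => [_|_]; split=> [//|[]] // [].
apply: (@is_amrsI _ _ sA (fun y x => reent A (sh x) y)).
- by move=> x /PE[].
- move=> i i_index; apply/PE; split=> //; apply: (amrs_root A_amrs).
  by move: i_index => /=; lia.
- by move=> x a /PE[? /(@amrs_prefix _ A_amrs (sh x) a) ?]; apply/PE.
- split.
  + by move=> x y [xi yi /(amrs_paths A_amrs)[? ?]]; split; apply/PE.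
  + by move=> x /PE[xi /(amrs_refl A_amrs)].
  + by move=> x y [xi yi /(amrs_sym A_amrs)].
  + by move=> x y z [xi yi xy] [_ zi yz]; split=> //; apply: amrs_trans yz.
- move=> x y a [xi yi xy] /PE[_ ya]; split=> //.
  exact: (amrs_fusion A_amrs xy ya).
- by move=> x /PE[_ /coverA].
- move=> y x z /PE[xi _] /PE[zi _] xy zy; split=> //.
  exact: (amrs_trans A_amrs) xy (amrs_sym A_amrs zy).
- by move=> x y [xi yi xy] /=; rewrite xi yi; apply: amrs_typ xy.
Qed.

End Closure.

(** * Abstractions of concrete structures *)

Section AbsAmrs.
Variables (F : finType) (d : Order.disp_t) (T : finTBPOrderType d).
Variables (N : eqType) (theta : N -> T).
Implicit Type s : mrs F N.

Lemma dpath_cat (delta : N -> F -> option N) q p a :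
  dpath delta q (p ++ a) = obind (fun q' => dpath delta q' a) (dpath delta q p).
Proof. by elim: p q => //= f p IHp q; case: (delta q f). Qed.

Lemma node_at_ext s x a :
  node_at s (ext x a) = obind (fun q => dpath (mrs_delta s) q a) (node_at s x).
Proof.
case: x => -[|i] p; rewrite /node_at //=.
by case: (onth (mrs_roots s) i) => //= q; rewrite dpath_cat.
Qed.

Lemma node_at_nodes s x q : node_at s x = Some q -> mrs_nodes s q.
Proof.
have dpath_nodes p r : mrs_nodes s r -> dpath (mrs_delta s) r p = Some q -> mrs_nodes s q.
  elim: p r => [|f p IHp] r /=; first by move=> ? [<-].
  by case E: (mrs_delta s r f) => [r'|] //= _; apply: IHp; case: (deltaP E).
case: x => -[|i] p; rewrite /node_at //=; case E: (onth (mrs_roots s) i) => [r|] //=.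
by apply: dpath_nodes; apply: roots_nodes; apply/onthP; exists i.
Qed.

Lemma paths_Abs s x : paths (Abs theta s) x <-> exists q, node_at s x = Some q.
Proof.
rewrite /paths /mkset [typ _ _]/=; case: (node_at s x) => [q|] /=; split=> -[t] // _.
  by exists q.
by exists (theta q).
Qed.

(** Each class consists of the paths leading to one node, and there are finitely many nodes. *)
Lemma Abs_amrs s : is_amrs (Abs theta s).
Proof.
have /finite_seqP[r nodesE] := nodes_finite s.
apply: (@is_amrsI _ _ _ _ _ r (fun q x => node_at s x = Some q)).
- move=> x /paths_Abs[q]; case: x => -[|i] p; rewrite /node_at //= => H.
  by rewrite -onthTE; case: (onth _ _) H.
- move=> [//|i] /= i_size; apply/paths_Abs; rewrite /node_at /=.
  by move: i_size; rewrite -onthTE; case: (onth _ _) => // q _; exists q.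
- move=> x a /paths_Abs[q]; rewrite node_at_ext => H; apply/paths_Abs.
  by case: (node_at s x) H => // q' _; exists q'.
- split.
  + by move=> x y [q xq yq]; split; apply/paths_Abs; exists q.
  + by move=> x /paths_Abs[q xq]; exists q.
  + by move=> x y [q xq yq]; exists q.
  + by move=> x y z [q xq yq] [q']; rewrite yq => -[<-]; exists q.
- move=> x y a [q xq yq] /paths_Abs[q' yaq']; exists q' => //.
  by rewrite -yaq' !node_at_ext xq yq.
- move=> x /paths_Abs[q xq]; exists q => //.
  by have := node_at_nodes xq; rewrite nodesE.
- by move=> q x y _ _ xq yq; exists q.
- by move=> x y [q xq yq] /=; rewrite xq yq.
Qed.

End AbsAmrs.

(** * Derivations as rewriting of lists *)

Section Rewriting.
Variables (F : finType) (d : Order.disp_t) (T : finTBPOrderType d).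
Implicit Types (X Y Z : pre_amrs F T) (s : seq (pre_amrs F T)).

(* The comparison is elementwise: sharing between different elements of Z is
   disregarded. *)
Definition all_at s Z o := forall a, a < size s -> le_at (nth lambda s a) 1 Z (o + a).

Definition approx s Z := size s = len Z /\ all_at s Z 1.

Lemma all_at_cat s1 s2 Z o :
  all_at (s1 ++ s2) Z o <-> all_at s1 Z o /\ all_at s2 Z (o + size s1).
Proof.
split=> [H|[H1 H2] a]; last first.
  rewrite size_cat nth_cat => a_size; case: ltnP => a1; first exact: H1.
  by have := H2 (a - size s1); rewrite -addnA subnKC //; apply; lia.
split=> a a_size; first by have := H a; rewrite size_cat nth_cat a_size; apply; lia.
have := H (size s1 + a); rewrite size_cat nth_cat addKn addnA.
by rewrite ifF; [apply|]; lia.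
Qed.

Lemma all_at_shift s Z o Z' o' : all_at s Z o ->
  (forall a, a < size s -> le_at Z (o + a) Z' (o' + a)) -> all_at s Z' o'.
Proof. by move=> sZ ZZ' a a_size; apply: le_at_trans (sZ a a_size) (ZZ' a a_size). Qed.

Lemma all_at1 X Z o : all_at [:: X] Z o <-> le_at X 1 Z o.
Proof. by split=> [/(_ 0 isT)|H [] // _] /=; rewrite addn0. Qed.

Variables (T_bc : bounded_complete T) (N : eqType) (theta : N -> T) (W : Type).
Variables (Cat : lexicon F theta W) (G : grammar Cat).

(** The quantified context makes the relation compatible with concatenation; requiring [Z'] to be an
    AMRS free of top makes it transitive. *)
Definition rewrites s s' := forall s1 s2 Z, is_amrs Z -> top_free Z ->
  approx (s1 ++ s ++ s2) Z ->
  exists Z', [/\ clos_refl_trans _ (strongly_derives G) Z Z',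
    is_amrs Z', top_free Z' & approx (s1 ++ s' ++ s2) Z'].

Lemma rewrites_refl s : rewrites s s.
Proof. by move=> s1 s2 Z *; exists Z; split=> //; apply: rt_refl. Qed.

Lemma rewrites_trans s s' s'' : rewrites s s' -> rewrites s' s'' -> rewrites s s''.
Proof.
move=> r r' s1 s2 Z ZA Zt /r[//|//|Z' [ZZ' ZA' Zt' /r'[//|//|Z'' [Z'Z'' ? ? ?]]]].
by exists Z''; split=> //; apply: rt_trans Z'Z''.
Qed.

Lemma rewrites_cat s s' t t' : rewrites s s' -> rewrites t t' ->
  rewrites (s ++ t) (s' ++ t').
Proof.
move=> rs rt; apply: (@rewrites_trans _ (s' ++ t)) => s1 s2 Z ZA Zt.
  by rewrite -!catA; apply: rs.
by rewrite -!catA !(catA s1); apply: rt.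
Qed.

(** [C] is any instance of the rule and [s] any list below its body. For a rule of length 1, [s] is
    empty and the element is erased. *)
Lemma rewrites_rule rho C s : rules G rho -> is_amrs C -> top_free C ->
  subsumes (Abs theta rho) C -> (size s).+1 = len C -> all_at s C 1 ->
  rewrites [:: elt C (len C)] s.
Proof.
move=> rhoG C_amrs C_top rhoC s_size sC s1 s2 Z Z_amrs Z_top.
rewrite /approx !size_cat => -[Z_len /all_at_cat[s1Z /all_at_cat[/all_at1 CZ s2Z]]].
pose m := len C; pose j := (size s1).+1; rewrite add1n -/j in CZ.
have C_index : 0 < m <= len C by rewrite /m -s_size leqnn.
have leCZ : le_at C m Z j by apply: le_at_trans CZ; apply: le_at_elt.
pose R := glue C Z m j; have R_amrs : is_amrs R by apply: glue_amrs.
have R_top : top_free R by apply: glue_top_free.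
have R_len : 0 < len R by rewrite /= -s_size.
have CR := embeds_glue C_amrs Z_amrs leCZ.
have RZ : elt R m = elt Z j by apply: elt_glue.
have j_index : 1 <= j <= len Z by rewrite /j -Z_len /=; lia.
pose Z' := replace Z j R.
have Z'_amrs : is_amrs Z' by apply: replace_amrs => //; rewrite RZ.
have Z'_top : top_free Z' by apply: replace_top_free.
have rho_len : size (mrs_roots rho) = m by case: rhoC => + _ _ _; apply.
have le_f := @le_at_replace_f _ _ _ Z R j R_amrs R_len j_index.
have le_g := @le_at_replace_g _ _ _ Z R j R_amrs R_len j_index.
exists Z'; split=> //.
  (* A single step, with the glued structure as the instance of [rho]; it is above [rho] through
     [C]. *)
  apply: rt_step; split=> //; exists rho, R, j; rewrite rho_len; split=> //.
  - split=> //; case: rhoC => /= H1 H2 H3 H4; split=> //.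
    + move=> [i p] /H2[t Ct].
      by case: CR => /(_ i p t isT Ct)[u Ru _] _; exists u.
    + by move=> [i p] [i' p'] /H3 Cxy; case: CR => _; apply.
    + move=> [i p] u v ru Rv; have [|t Ct] := H2 (i, p); first by exists u.
      case: CR => /(_ i p t isT Ct)[v' Rv' tv'] _.
      have -> : v = v' by move: Rv'; rewrite Rv => -[].
      exact: le_trans (H4 _ _ _ ru Ct) tv'.
  - split=> //.
      rewrite RZ; symmetry; apply: unif_absorb => //.
      have [Et Er] := elt_le_at Z j.
      split=> [i p t /eqP-> /Et //|i i' p q /eqP-> /eqP->]; exact: Er.
    rewrite -RZ; symmetry; apply: unif_absorb => //.
    have [Et Er] := elt_le_at R m.
    split=> [i p t /eqP-> /Et //|i i' p q /eqP-> /eqP->]; exact: Er.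
  (* The body of [R] lands at the positions from [j] to [j + m - 2]. *)
  - move=> m2; exists j; split=> //; first by rewrite [len _]/= -/m; lia.
    have sub_R := sub_replace R_amrs R_len j_index m2.
    rewrite -[m]/(len R) sub_R; have S_amrs : is_amrs (sub R 1 (len R - 1)).
      by apply: sub_amrs => //; lia.
    split; symmetry; apply: unif_absorb => //; first by split=> // i p t _; exists t.
    split=> [i p t im|i i' p q _ _] /=; last by rewrite !addnK => -[].
    by rewrite addnK; case: ifP => // _ ->; exists t.
  - by symmetry; apply: closure_id.
have Z'_len : len Z' = len Z + m - 2 by [].
split; first (rewrite Z'_len -Z_len /m -s_size /=; lia).
apply/all_at_cat; split; last (apply/all_at_cat; split).
- apply: all_at_shift s1Z _ => a a_size; have a_j : 1 + a < j by rewrite /j; lia.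
  by have := le_f (1 + a); rewrite /repl_f a_j; apply; lia.
- apply: all_at_shift sC _ => a a_size.
  have a_m : 0 < 1 + a < m by rewrite /m -s_size; lia.
  have -> : 1 + size s1 + a = repl_g j (1 + a) by rewrite /repl_g /j; lia.
  apply: le_at_trans (le_g _ a_m).
  exact: embeds_le_at CR _.
- apply: all_at_shift s2Z _ => a a_size.
  (* The old position in [Z], behind [s1] and the one replaced element. *)
  pose i := 1 + size s1 + size [:: elt C (len C)] + a.
  have -> : 1 + size s1 + size s + a = repl_f j m i.
    by rewrite /repl_f ifF /i /m -?s_size /j /=; lia.
  by apply: le_f; rewrite /i /j /=; lia.
Qed.

(** * Lists of lexical categories and their concatenation *)

Fixpoint lexlist (u : seq W) s : Prop :=
  match u, s with
  | [::], [::] => True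
  | a :: u', X :: s' => (exists2 A : tfs F N, Cat a A & X = Abs theta A) /\ lexlist u' s'
  | _, _ => False
  end.

Lemma lexlist_cat u s v t : lexlist u s -> lexlist v t -> lexlist (u ++ v) (s ++ t).
Proof. by elim: u s => [|a u IHu] [|X s] //= [? /IHu us] /us. Qed.

Definition lexcat s : pre_amrs F T := foldr (@concat F d T) lambda s.

Lemma lexlist_PTseq u s : lexlist u s -> PTseq Cat u (lexcat s).
Proof.
elim: u s => [|a u IHu] [|X s] //= [[A aA ->] /IHu us].
by exists A => //; exists (lexcat s).
Qed.

Lemma len_lexcat u s : lexlist u s -> len (lexcat s) = size s.
Proof.
elim: u s => [|a u IHu] [|X s] //= [[A aA ->] /IHu ->].
by rewrite [len (Abs _ _)]/= tfs_size.
Qed.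

(** The offset [o] lets the induction strip elements from the list while [Z] stays whole. *)
Lemma lexcat_typ u s Z o i p t : lexlist u s -> all_at s Z o.+1 ->
  typ (lexcat s) (i, p) = Some t ->
  exists2 t', typ Z (i + o, p) = Some t' & (t <= t')%O.
Proof.
elim: u s o i => [|a u IHu] [|X s] //= o i [[A aA ->] us] sZ.
have [/all_at1 [AZ _] sZ'] : all_at [:: Abs theta A] Z o.+1 /\ all_at s Z (o.+1 + 1).
  exact/(all_at_cat [:: Abs theta A]).
rewrite /= tfs_size; case: ifP => [i1|i1] ti.
  (* The test in [concat] also lets index 0 through, but an abstraction has no path there. *)
  have := @amrs_index _ _ _ _ (Abs_amrs theta A) (i, p); rewrite /= tfs_size => H.
  have iE : i = 1 by have : 1 <= i <= 1 by [apply: H; exists t]; lia.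
  by rewrite iE in ti *; rewrite add1n; apply: AZ.
rewrite addn1 in sZ'; have [t' Zt' tt'] := IHu _ _ _ us sZ' ti.
by exists t' => //; rewrite -Zt'; congr (typ Z (_, _)); lia.
Qed.

Lemma lexcat_reent u s Z o i j p q : lexlist u s -> all_at s Z o.+1 ->
  reent (lexcat s) (i, p) (j, q) -> reent Z (i + o, p) (j + o, q).
Proof.
elim: u s o i j => [|a u IHu] [|X s] //= o i j [[A aA ->] us] sZ.
have [/all_at1 [_ AZ] sZ'] : all_at [:: Abs theta A] Z o.+1 /\ all_at s Z (o.+1 + 1).
  exact/(all_at_cat [:: Abs theta A]).
rewrite /= tfs_size => -[[i1 j1 ij]|[i1 j1 ij]].
  have A_index := @amrs_index _ _ _ _ (Abs_amrs theta A).
  have [/A_index + /A_index] := amrs_paths (Abs_amrs theta A) ij.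
  rewrite /= tfs_size => iE jE; have [? ?] : i = 1 /\ j = 1 by lia.
  by subst i j; rewrite add1n; apply: AZ.
rewrite addn1 in sZ'; have := IHu _ _ _ _ us sZ' ij.
by congr (reent Z (_, _) (_, _)); lia.
Qed.

(** Different elements of a concatenation share nothing, so the elementwise comparison already
    yields full subsumption. *)
Lemma subsumes_lexcat u s Z : lexlist u s -> approx s Z -> subsumes (lexcat s) Z.
Proof.
move=> us [s_size sZ]; split; first by rewrite (len_lexcat us).
- by move=> [i p] [t /(lexcat_typ us sZ)[t' + _]]; rewrite addn0; exists t'.
- by move=> [i p] [j q] /(lexcat_reent us sZ); rewrite !addn0.
- by move=> [i p] t t' /(lexcat_typ us sZ)[t'']; rewrite addn0 => -> ? [<-].
Qed.

(** * Soundness of the computed items *)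

Variable w : seq W.

(** For an active item, [s] is only required to be below: unifications refine the elements of the
    item, while the rewriting found earlier for [s] remains available. *)
Definition sound (x : item F T) := exists s t,
  [/\ lexlist (drop (ifrom x) (take (ito x) w)) t, rewrites s t
    & if istatus x is Act then approx s (icat x) else s = [:: icat x]].

Lemma drop_take_cat (S : Type) (v : seq S) i j k : i <= j -> j <= k ->
  drop i (take k v) = drop i (take j v) ++ drop j (take k v).
Proof.
move=> ij jk; rewrite -{1}(cat_take_drop j (take k v)) take_takel // drop_cat.
case: ltnP => // i_size; rewrite (drop_oversize i_size) /=.
have [jv|vj] := leqP j (size v).
  move: i_size; rewrite size_takel // => ji.
  by rewrite (_ : i - j = 0) ?drop0 //; lia.
by rewrite [drop j _]drop_oversize // size_take; case: ifP; lia.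
Qed.

(** Unification is an upper bound of its operands, so the list of the active item, followed by the
    complete category, stays below the extended structure; the two rewritings are juxtaposed. *)
Lemma sound_extend I x : I `<=` sound -> I `<=` (@is_item _ _ _) ->
  T_extend G I x -> sound x.
Proof.
move=> I_sound I_item [rho [k [ia [ja [ib [jb [Aa [Ab]]]]]]]] /=.
set B := unify _ _ Aa; set C := unify1 _ _ Ab.
case=> _ _ [xa Aa_len xb Ab_len jaE] _ ->.
have [ia_ja _ _] := I_item _ xa; have [ib_jb _ _] := I_item _ xb.
have [s [t [/= lexa rwa [s_size sA]]]] := I_sound _ xa.
have [s' [t' [/= lexb rwb s'E]]] := I_sound _ xb; rewrite {}s'E in rwb.
rewrite /= in ia_ja ib_jb; subst ib.
exists (s ++ [:: Ab]), (t ++ t'); split=> /=.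
- by rewrite (drop_take_cat w ia_ja ib_jb); apply: lexlist_cat.
- exact: rewrites_cat.
have C_B := unif_embedsl (fun=> 1) B (pred1 k.+1) Ab T_bc.
split; first by rewrite size_cat s_size Aa_len /= addn1 subn1.
apply/all_at_cat; split.
  apply: all_at_shift sA _ => a; rewrite s_size Aa_len => a_k.
  apply: (@le_at_trans _ _ _ _ _ C (1 + a)); last by apply: le_at_sub; lia.
  apply: (@le_at_trans _ _ _ _ _ B (1 + a)); last exact: embeds_le_at C_B _.
  apply: (@embeds_le_at _ _ _ id (upto k) B Aa (1 + a) (unif_embedsr _ _ _ _ T_bc)).
  by rewrite /upto /=; lia.
apply/all_at1; rewrite s_size Aa_len add1n.
apply: (@le_at_trans _ _ _ _ _ C k.+1); last by apply: le_at_sub.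
by apply: (embeds_le_at (unif_embedsr (fun=> 1) B (pred1 k.+1) Ab T_bc)) => /=.
Qed.

(** Unification puts the body of the rule instance [C] above [s], so its head rewrites to [s] and
    then to [t]. *)
Lemma sound_complete I x : I `<=` sound -> I `<=` (@is_item _ _ _) ->
  T_complete G I x -> sound x.
Proof.
move=> I_sound I_item [rho [ia [ja [Aa]]]] /=; set m := size _; set C := unify _ _ _.
case=> -[rhoG m1] [xa Aa_len] C_top ->.
have [_ /= Aa_amrs _] := I_item _ xa.
have [s [t [/= lexa rwa [s_size sA]]]] := I_sound _ xa.
exists [:: elt C m], t; split=> //=; apply: rewrites_trans rwa.
have J_index i : upto (m - 1) i -> 1 <= i <= len (Abs theta rho).
  by rewrite /upto /= -/m; lia.
apply: (@rewrites_rule rho) => //.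
- exact: unif_amrs (Abs_amrs theta rho) Aa_amrs J_index.
- have [Ct Cr] := unif_embedsl id (Abs theta rho) (upto (m - 1)) Aa T_bc.
  split=> //; first by move=> [i p] [t' /Ct[//|u Cu _]]; exists u.
    by move=> [i p] [j q] /Cr; apply.
  by move=> [i p] u v /Ct[//|u' Cu uu'] Cv; move: Cu; rewrite [typ _ _]Cv => -[->].
- by rewrite s_size Aa_len /= -/m; lia.
- apply: all_at_shift sA _ => a; rewrite s_size Aa_len => a_m.
  apply: (@embeds_le_at _ _ _ id (upto (m - 1)) C Aa (1 + a) (unif_embedsr _ _ _ _ T_bc)).
  by rewrite /upto /=; lia.
Qed.

Lemma sound_init (x : item F T) : T_init w x -> sound x.
Proof.
move=> [i _ ->]; exists [::], [::]; split=> //=; last exact: rewrites_refl.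
by rewrite drop_oversize // size_take; case: ifP => // /negbT; lia.
Qed.

Lemma sound_empty x : T_empty G w x -> sound x.
Proof.
move=> [i [rho [_ rhoG rho1 ->]]]; exists [:: Abs theta rho], [::]; split=> //=.
  by rewrite drop_oversize // size_take; case: ifP => // /negbT; lia.
(* A rule of length 1 is its own head, hence rewrites to the empty list. *)
have Abs_elt : elt (Abs theta rho) (len (Abs theta rho)) = Abs theta rho.
  have rho_index := @amrs_index _ _ _ _ (Abs_amrs theta rho).
  rewrite /= rho1 in rho_index *.
  apply: pre_amrs_ext => [|[j p]|[j p] [j' p']]; rewrite ?[len _]/= ?rho1 //.
    rewrite [LHS]/= addnK; case: ifP => // /negbT j1.
    case E: (typ _ _) => [t|//]; case/negP: j1.
    by apply: (rho_index (j, p)); exists t.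
  rewrite [X in X <-> _]/= !addnK; split=> [[]//|H]; split=> //.
    by have [/rho_index] := amrs_paths (Abs_amrs theta rho) H.
  by have [_ /rho_index] := amrs_paths (Abs_amrs theta rho) H.
rewrite -{1}Abs_elt; apply: (@rewrites_rule rho) => //; first exact: Abs_amrs.
- exact: rules_top_free rhoG.
- by split=> // y u v -> [->].
Qed.

Lemma sound_scan x : T_scan Cat w x -> sound x.
Proof.
move=> [i [u [A [/andP[i0 i_size] wi uA ->]]]].
exists [:: Abs theta A], [:: Abs theta A]; split=> //=; last exact: rewrites_refl.
suff -> : drop (i - 1) (take i w) = [:: u] by split=> //; exists A.
case: i i0 i_size wi => // i _ i_size; rewrite subn1 /= => wi.
rewrite (take_nth u) // (onth_nth u _ _ _ wi) drop_rcons; last by rewrite size_takel // ltnW.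
by rewrite drop_oversize // size_takel // ltnW.
Qed.

Lemma computation_sound l : computation G w l `<=` [set x | is_item x /\ sound x].
Proof.
elim: l => [//|l IHl] x [x_item xT]; split=> //.
have I_sound : computation G w l `<=` sound by move=> y /IHl[].
have I_item : computation G w l `<=` (@is_item _ _ _) by move=> y /IHl[].
case: xT => [||[]].
- exact: sound_extend.
- exact: sound_complete.
- exact: sound_init.
- exact: sound_empty.
- exact: sound_scan.
Qed.

(** Success and [derives] unify with the start structure in opposite orders. The two merges agree
    because both structures have paths at index 1 only. *)
Lemma unify1C (A B : pre_amrs F T) : is_amrs A -> is_amrs B -> len A = 1 -> len B = 1 ->
  unify1 A 1 B = unify B (upto 1) A.
Proof.
move=> A_amrs B_amrs A1 B1.
have idx X x : is_amrs X -> len X = 1 -> paths X x -> x.1 = 1.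
  by move=> X_amrs X1 /(amrs_index X_amrs); rewrite X1; lia.
have nidx X i p : is_amrs X -> len X = 1 -> i <> 1 -> typ X (i, p) = None.
  move=> X_amrs X1 i1; case E: (typ X (i, p)) => [t|//].
  by case: i1; apply: (idx X (i, p)) => //; exists t.
congr closure; apply: pre_amrs_ext => [|[i p]|[i p] [j q]] /=; first by rewrite A1.
  case: eqP => [->|i1] /=; last first.
    by rewrite !nidx //; case: ifP => // i1'; rewrite !nidx.
  by case: (typ A _) (typ B _) => [u|] [v|] //=; rewrite setUC.
split=> -[H|[i1 j1 H]].
- have [/(idx _ _ A_amrs A1) /= i1 /(idx _ _ A_amrs A1) /= j1] := amrs_paths A_amrs H.
  by right; rewrite i1 j1 /= in H *.
- by left; rewrite (eqP i1) (eqP j1).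
- have [/(idx _ _ B_amrs B1) /= i1 /(idx _ _ B_amrs B1) /= j1] := amrs_paths B_amrs H.
  by right; rewrite i1 j1 /= in H *.
- by left.
Qed.

End Rewriting.

Theorem theorem2p10p4
  (F : finType) (F_nonempty : 0 < #|F|)
  (d : Order.disp_t) (T : finTBPOrderType d) (T_bc : bounded_complete T)
  (N : eqType) (theta : N -> T)
  (N_infinite : infinite_set [set: N])
  (theta_infinite : forall t : T, infinite_set [set q | theta q = t])
  (W : Type) (Cat : lexicon F theta W) (G : grammar Cat) (w : seq W) :
  successful G w -> language G w.
Proof.
move=> [l [A [/(computation_sound T_bc)[[_ A_amrs A_top] sA] A1 start_top]]].
case: sA => s [t [/= lex_t + sE]]; rewrite {}sE => rw.
have approxA : approx [:: A] A.
  by split; [rewrite A1 | apply/all_at1; apply: le_at_refl].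
have [Z [AZ Z_amrs Z_top]] := rw [::] [::] A A_amrs A_top approxA.
rewrite /= cats0 => tZ; rewrite drop0 take_size in lex_t.
exists (lexcat t); first by rewrite /PT subnn drop0 take_size; apply: lexlist_PTseq.
(* The derivation starts at the category of the successful item, which unifies with the start
   structure. *)
exists A, Z; split=> //.
- by rewrite A1 /= tfs_size.
- rewrite [len _]/= tfs_size -unify1C //; [exact: Abs_amrs | exact: tfs_size].
- exact: subsumes_lexcat lex_t tZ.
Qed.
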